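(* Assume that $k,\rho,c$ and $\mu$ (with $v(T)=\mu(T)/\sqrt t$) satisfy the boundedness and Lipschitz hypotheses (K), (R), (V) listed in the context, and that $$\frac{2k_M\widetilde k\,(T^*-T_m)}{k_m^2}<1 .$$ Let $\lambda_2>0$ be a solution of $\mathcal V_2(\lambda)=\lambda$, and assume $\mathcal E_h(\lambda_2)<1$. Then there exists at least one solution $(T,s)$ of the Stefan problem $$\rho(T)c(T)\frac{\partial T}{\partial t}=\frac{\partial}{\partial x}\Big(k(T)\frac{\partial T}{\partial x}\Big)-v(T)\frac{\partial T}{\partial x},\quad 0<x<s(t),\ t>0,$$ $$k(T(0,t))\frac{\partial T}{\partial x}(0,t)=\frac{h}{\sqrt t}\big[T(0,t)-T^*\big],\quad T(s(t),t)=T_m,\quad k(T(s(t),t))\frac{\partial T}{\partial x}(s(t),t)=-\rho_0\ell\,\dot s(t),\quad t>0,\quad s(0)=0,$$ where the free boundary is $s(t)=2\widetilde\lambda_h\sqrt{\alpha_0t}$, $t>0$, with $\widetilde\lambda_h\in(0,\lambda_2)$ a solution of $\mathcal V^h(\lambda)=\lambda$, and the temperature is $$T(x,t)=(T_m-T^* )f_{\widetilde\lambda_h}(\xi)+T^*,\qquad \xi=\frac{x}{2\sqrt{\alpha_0t}},\quad 0\le\xi\le\widetilde\lambda_h,$$ where $f_{\widetilde\lambda_h}\in C^0[0,\widetilde\lambda_h]$ is the unique solution of $f(\xi)=\dfrac{1+2\mathrm{Bi}\,\Phi(f)(\xi)}{1+2\mathrm{Bi}\,\Phi(f)(\widetilde\lambda_h)}$,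 $0\le\xi\le\widetilde\lambda_h$.
   Context: Data: real constants $T^*>T_m$; positive constants $h,\rho_0,c_0,k_0,\ell$; $\alpha_0=k_0/(\rho_0c_0)$; $\mathrm{Ste}=(T^*-T_m)c_0/\ell>0$; $\mathrm{Bi}=h\sqrt{\alpha_0}/k_0>0$. The coefficients $k,\rho,c,\mu$ are real functions of temperature acting by composition, e.g. $k(T)(x,t)=k(T(x,t))$, and the convective speed is $v(T)=\mu(T)/\sqrt t$. Let $\mathscr C=C^0(\mathbb R_0^+\times\mathbb R^+)\cap L^\infty(\mathbb R_0^+\times\mathbb R^+)$ with the supremum norm $\|\cdot\|$. Hypotheses: there are positive constants $k_m,k_M,\widetilde k,\gamma_m,\gamma_M,\widetilde\gamma,\nu_m,\nu_M,\widetilde\nu$ such that for all $T,T_1,T_2\in\mathscr C$: (K) $k_m\le k(T)\le k_M$ and $\|k(T_1)-k(T_2)\|\le\widetilde k\|T_1-T_2\|$; (R) $\gamma_m\le\rho(T)c(T)\le\gamma_M$ and $\|\rho(T_1)c(T_1)-\rho(T_2)c(T_2)\|\le\widetilde\gamma\|T_1-T_2\|$; (V) $\nu_m\le\mu(T)\le\nu_M$ and $\|\mu(T_1)-\mu(T_2)\|\le\widetilde\nu\|T_1-T_2\|$. For a function $f$ of $\xi$ put $T=(T_m-T^* )f+T^*$ and $L^*(f)=k(T)/k_0$, $N^*(f)=\rho(T)c(T)/(\rho_0c_0)$, $\mu^*(f)=\mu(T)/\sqrt{\rho_0c_0k_0}$ (pointwise in $\xi$). Constants: $L_m=k_m/k_0$,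 $L_M=k_M/k_0$, $\widetilde L=\widetilde k(T^*-T_m)/k_0$, $N_m=\gamma_m/(\rho_0c_0)$, $N_M=\gamma_M/(\rho_0c_0)$, $\widetilde N=\widetilde\gamma(T^*-T_m)/(\rho_0c_0)$, $\mu_m=\nu_m/\sqrt{\rho_0c_0k_0}$, $\mu_M=\nu_M/\sqrt{\rho_0c_0k_0}$, $\widetilde\mu=\widetilde\nu(T^*-T_m)/\sqrt{\rho_0c_0k_0}$. For $f\in C^0[0,\lambda]$: $U(f)(z)=\exp\big(2\int_0^z\frac{\mu^*(f)(\sigma)}{L^*(f)(\sigma)}d\sigma\big)$, $I(f)(z)=\exp\big(2\int_0^z\frac{\sigma N^*(f)(\sigma)}{L^*(f)(\sigma)}d\sigma\big)$, $E(f)=U(f)/I(f)$, $\Phi(f)(\xi)=\int_0^\xi\frac{E(f)(z)}{L^*(f)(z)}dz$. Define, for $z\ge0$, $D_1(z)=\frac{2\exp(2\mu_Mz/L_m)}{L_m^2}z(\mu_M\widetilde L+L_m\widetilde\mu)$, $D_2(z)=\frac{\exp(N_Mz^2/L_m)}{L_m^2}z^2(N_M\widetilde L+L_m\widetilde N)$, $D_3(z)=\exp(\frac{N_M}{L_m}z^2)D_1(z)+\exp(2\frac{\mu_M}{L_m}z)D_2(z)$, $D_4(z)=\frac1{L_m^2}\big(\widetilde L\exp(2z\frac{\mu_M}{L_m})+L_mD_3(z)\big)$, and $\mathcal E_h(z)=2L_MD_4(z)\exp(\frac{N_M}{L_m}z^2)$. Under the stated smallness condition there is a unique $\overline\lambda_h>0$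 with $\mathcal E_h(\overline\lambda_h)=1$, and for each $0<\lambda<\overline\lambda_h$ there is a unique $f_\lambda\in C^0[0,\lambda]$ with $f_\lambda(\xi)=\frac{1+2\mathrm{Bi}\,\Phi(f_\lambda)(\xi)}{1+2\mathrm{Bi}\,\Phi(f_\lambda)(\lambda)}$ on $[0,\lambda]$. Set $\mathcal V^h(\lambda)=\frac{\mathrm{Ste}\,\mathrm{Bi}\,E(f_\lambda)(\lambda)}{1+2\mathrm{Bi}\,\Phi(f_\lambda)(\lambda)}$ for $0<\lambda<\overline\lambda_h$. For $\lambda>0$: $\mathcal V_2(\lambda)=\frac{\mathrm{Ste}}{\sqrt\pi}\frac{\sqrt{N_M}}{\sqrt{L_m}}L_M\frac{\exp(2\lambda\mu_M/L_m-\lambda^2N_m/L_M)}{\operatorname{erf}(\sqrt{N_M/L_m}\,\lambda)}$; the equation $\mathcal V_2(\lambda)=\lambda$ has at least one positive solution. *)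

(* Defs.v *)
From Stdlib Require Import Reals ClassicalEpsilon.
From Coquelicot Require Import Coquelicot.

Set Implicit Arguments.
Unset Strict Implicit.
Unset Printing Implicit Defensive.

Open Scope R_scope.

(* Functions on an interval [0, a] or on a space-time region are total functions
   whose values off that set are irrelevant. *)

Definition erf (x : R) : R := 2 / sqrt PI * RInt (fun u => exp (- u ^ 2)) 0 x.

Definition right_derive (g : R -> R) (a l : R) : Prop :=
  filterlim (fun y => (g y - g a) / (y - a)) (at_right a) (locally l).

Definition left_derive (g : R -> R) (a l : R) : Prop :=
  filterlim (fun y => (g y - g a) / (y - a)) (at_left a) (locally l).

Definition quarter (p : R * R) : Prop := 0 <= fst p /\ 0 < snd p.

(* C^0 /\ L^infty on [0, +oo) x (0, +oo); first argument x, second argument t. *)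
Definition calC (T : R -> R -> R) : Prop :=
  continuous_on quarter (fun p : R * R => T (fst p) (snd p)) /\
  exists M : R, forall x t, 0 <= x -> 0 < t -> Rabs (T x t) <= M.

Definition supnorm (F : R -> R -> R) : Rbar :=
  Lub_Rbar (fun y => exists x t, 0 <= x /\ 0 < t /\ y = Rabs (F x t)).

Definition bounded_lipschitz (g : R -> R) (lo hi lip : R) : Prop :=
  (forall T, calC T -> forall x t, 0 <= x -> 0 < t -> lo <= g (T x t) <= hi) /\
  (forall T1 T2, calC T1 -> calC T2 ->
     Rbar_le (supnorm (fun x t => g (T1 x t) - g (T2 x t)))
             (Rbar_mult lip (supnorm (fun x t => T1 x t - T2 x t)))).

Record data : Type := Data {
  Tm : R;
  Tstar : R;
  hconv : R;  (* h *)
  rho0 : R;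
  c0 : R;
  k0 : R;
  ell : R;
  kf : R -> R;
  rhof : R -> R;
  cf : R -> R;
  muf : R -> R
}.

Definition alpha0 (d : data) : R := k0 d / (rho0 d * c0 d).
Definition Ste (d : data) : R := (Tstar d - Tm d) * c0 d / ell d.
Definition Bi (d : data) : R := hconv d * sqrt (alpha0 d) / k0 d.

Definition positive_data (d : data) : Prop :=
  Tm d < Tstar d /\ 0 < hconv d /\ 0 < rho0 d /\ 0 < c0 d /\ 0 < k0 d /\ 0 < ell d.

(* Constants of the hypotheses on k, rho c and mu:
   (k_m, k_M, k~), (gamma_m, gamma_M, gamma~), (nu_m, nu_M, nu~). *)
Record bounds : Type := Bounds {
  k_lo : R;
  k_hi : R;
  k_lip : R;
  gamma_lo : R;
  gamma_hi : R;
  gamma_lip : R;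
  nu_lo : R;
  nu_hi : R;
  nu_lip : R
}.

Definition positive_bounds (b : bounds) : Prop :=
  0 < k_lo b /\ 0 < k_hi b /\ 0 < k_lip b /\
  0 < gamma_lo b /\ 0 < gamma_hi b /\ 0 < gamma_lip b /\
  0 < nu_lo b /\ 0 < nu_hi b /\ 0 < nu_lip b.

Definition hyp_K (d : data) (b : bounds) : Prop :=
  bounded_lipschitz (kf d) (k_lo b) (k_hi b) (k_lip b).
Definition hyp_R (d : data) (b : bounds) : Prop :=
  bounded_lipschitz (fun u => rhof d u * cf d u) (gamma_lo b) (gamma_hi b) (gamma_lip b).
Definition hyp_V (d : data) (b : bounds) : Prop :=
  bounded_lipschitz (muf d) (nu_lo b) (nu_hi b) (nu_lip b).

Definition temp (d : data) (f : R -> R) (xi : R) : R := (Tm d - Tstar d) * f xi + Tstar d.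

Definition Ls (d : data) (f : R -> R) (xi : R) : R := kf d (temp d f xi) / k0 d.
Definition Ns (d : data) (f : R -> R) (xi : R) : R :=
  rhof d (temp d f xi) * cf d (temp d f xi) / (rho0 d * c0 d).
Definition mus (d : data) (f : R -> R) (xi : R) : R :=
  muf d (temp d f xi) / sqrt (rho0 d * c0 d * k0 d).

Definition L_m (d : data) (b : bounds) : R := k_lo b / k0 d.
Definition L_M (d : data) (b : bounds) : R := k_hi b / k0 d.
Definition L_t (d : data) (b : bounds) : R := k_lip b * (Tstar d - Tm d) / k0 d.
Definition N_m (d : data) (b : bounds) : R := gamma_lo b / (rho0 d * c0 d).
Definition N_M (d : data) (b : bounds) : R := gamma_hi b / (rho0 d * c0 d).
Definition N_t (d : data) (b : bounds) : R :=
  gamma_lip b * (Tstar d - Tm d) / (rho0 d * c0 d).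
Definition mu_M (d : data) (b : bounds) : R := nu_hi b / sqrt (rho0 d * c0 d * k0 d).
Definition mu_t (d : data) (b : bounds) : R :=
  nu_lip b * (Tstar d - Tm d) / sqrt (rho0 d * c0 d * k0 d).

Definition Uf (d : data) (f : R -> R) (z : R) : R :=
  exp (2 * RInt (fun sg => mus d f sg / Ls d f sg) 0 z).
Definition If (d : data) (f : R -> R) (z : R) : R :=
  exp (2 * RInt (fun sg => sg * Ns d f sg / Ls d f sg) 0 z).
Definition Ef (d : data) (f : R -> R) (z : R) : R := Uf d f z / If d f z.
Definition Phi (d : data) (f : R -> R) (xi : R) : R :=
  RInt (fun z => Ef d f z / Ls d f z) 0 xi.

Definition D1 (d : data) (b : bounds) (z : R) : R :=
  2 * exp (2 * mu_M d b * z / L_m d b) / L_m d b ^ 2 * z *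
  (mu_M d b * L_t d b + L_m d b * mu_t d b).
Definition D2 (d : data) (b : bounds) (z : R) : R :=
  exp (N_M d b * z ^ 2 / L_m d b) / L_m d b ^ 2 * z ^ 2 *
  (N_M d b * L_t d b + L_m d b * N_t d b).
Definition D3 (d : data) (b : bounds) (z : R) : R :=
  exp (N_M d b / L_m d b * z ^ 2) * D1 d b z +
  exp (2 * (mu_M d b / L_m d b) * z) * D2 d b z.
Definition D4 (d : data) (b : bounds) (z : R) : R :=
  / L_m d b ^ 2 *
  (L_t d b * exp (2 * z * (mu_M d b / L_m d b)) + L_m d b * D3 d b z).
Definition calE (d : data) (b : bounds) (z : R) : R :=
  2 * L_M d b * D4 d b z * exp (N_M d b / L_m d b * z ^ 2).

(* f is in C^0[0, lam] and solves the integral equation on [0, lam]. *)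
Definition solves (d : data) (lam : R) (f : R -> R) : Prop :=
  continuous_on (fun xi => 0 <= xi <= lam) f /\
  forall xi, 0 <= xi <= lam ->
    f xi = (1 + 2 * Bi d * Phi d f xi) / (1 + 2 * Bi d * Phi d f lam).

Definition solves_uniquely (d : data) (lam : R) (f : R -> R) : Prop :=
  solves d lam f /\
  forall g, solves d lam g -> forall xi, 0 <= xi <= lam -> g xi = f xi.

(* A representative of the solution f_lam, meaningful when it exists. *)
Definition f_ (d : data) (lam : R) : R -> R :=
  epsilon (inhabits (fun _ : R => 0)) (solves d lam).

Definition Vh (d : data) (lam : R) : R :=
  Ste d * Bi d * Ef d (f_ d lam) lam / (1 + 2 * Bi d * Phi d (f_ d lam) lam).

Definition V2 (d : data) (b : bounds) (lam : R) : R :=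
  Ste d / sqrt PI * (sqrt (N_M d b) / sqrt (L_m d b)) * L_M d b *
  (exp (2 * lam * mu_M d b / L_m d b - lam ^ 2 * N_m d b / L_M d b) /
   erf (sqrt (N_M d b / L_m d b) * lam)).

Definition vconv (d : data) (T : R -> R -> R) (x t : R) : R := muf d (T x t) / sqrt t.

Definition heat_equation (d : data) (T : R -> R -> R) (x t : R) : Prop :=
  let flux := fun y => kf d (T y t) * Derive (fun z => T z t) y in
  ex_derive (fun tau => T x tau) t /\
  ex_derive (fun y => T y t) x /\
  ex_derive flux x /\
  rhof d (T x t) * cf d (T x t) * Derive (fun tau => T x tau) t =
    Derive flux x - vconv d T x t * Derive (fun y => T y t) x.

(* Classical solution. At the ends x = 0 and x = s(t) of the space domain the
   derivative dT/dx is one-sided. *)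
Definition stefan_solution (d : data) (T : R -> R -> R) (s : R -> R) : Prop :=
  continuous_on (fun t => 0 <= t) s /\
  continuous_on (fun p : R * R => 0 < snd p /\ 0 <= fst p <= s (snd p))
    (fun p => T (fst p) (snd p)) /\
  (forall x t, 0 < t -> 0 < x < s t -> heat_equation d T x t) /\
  (forall t, 0 < t ->
     exists q, right_derive (fun x => T x t) 0 q /\
       kf d (T 0 t) * q = hconv d / sqrt t * (T 0 t - Tstar d)) /\
  (forall t, 0 < t -> T (s t) t = Tm d) /\
  (forall t, 0 < t ->
     ex_derive s t /\
     exists q, left_derive (fun x => T x t) (s t) q /\
       kf d (T (s t) t) * q = - rho0 d * ell d * Derive s t) /\
  s 0 = 0.

(* Main.v *)
Require Import Defs.
From Stdlib Require Import Reals Lra Lia ClassicalEpsilon.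
From Coquelicot Require Import Coquelicot.
Open Scope R_scope.

(** Under the similarity variable xi = x / (2 sqrt (alpha_0 t)) the Stefan problem becomes
    the fixed point equation f = (1 + 2 Bi Phi(f)) / (1 + 2 Bi Phi(f)(lam)) together with
    the scalar equation V^h(lam) = lam.  The fixed point operator is a contraction of
    C^0[0, lam] with constant E_h(lam), which increases from a value less than 1 at 0 to
    infinity.  It is moreover Lipschitz in lam uniformly in f, so f_lam and hence V^h are
    Lipschitz in lam on (0, lambda_2].  Since V^h is bounded below by a positive constant
    there and V^h(lambda_2) < V_2(lambda_2) = lambda_2, the intermediate value theorem
    gives a root of V^h(lam) = lam. *)

(** * Real analysis *)

(** It is avoided: with A = 1 + 2 Bi Phi(f)(lam), the fixed point satisfies L f' = (2 Bi / A) E on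
    (0, lam), so the flux is a constant multiple of E, which is differentiable whatever the
    regularity of k. The equation E' = 2 ((mu - xi N) / L) E is then the heat equation in the
    similarity variable. The boundary conditions correspond to E(0) = 1 and f(0) = 1 / A
    (convection), f(lam) = 1 (melting temperature) and V^h(lam) = lam (Stefan condition).

    Two obstacles shape the estimates. The profiles live on intervals that change with lam, and [f_]
    is chosen by [epsilon], hence arbitrary off [0, lam] and a priori unrelated for different lam.
    Profiles are therefore extended to the whole line by their end values, which makes those of
    different lam comparable, and regularity in lam is drawn from the contraction alone. *)

Lemma calC_const (u : R) : calC (fun _ _ => u).
Proof.
split.
- intros p _. apply filterlim_const.
- exists (Rabs u). intros. apply Rle_refl.
Qed.

Lemma supnorm_const (u : R) : supnorm (fun _ _ => u) = Rabs u.
Proof.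
apply is_lub_Rbar_unique. split.
- intros y (x & t & _ & _ & ->). apply Rle_refl.
- intros M HM. apply HM. exists 0, 1. repeat split; lra.
Qed.

(* Constant temperature fields turn the hypotheses on [calC] into pointwise ones. *)
Lemma bounded_lipschitz_pointwise (g : R -> R) (lo hi lip : R) :
  bounded_lipschitz g lo hi lip ->
  (forall u, lo <= g u <= hi) /\
  (forall u v, Rabs (g u - g v) <= lip * Rabs (u - v)).
Proof.
intros [Hb Hl]. split.
- intros u. apply (Hb _ (calC_const u) 0 1); lra.
- intros u v. generalize (Hl _ _ (calC_const u) (calC_const v)).
  now rewrite !supnorm_const.
Qed.

Lemma lipschitz_continuous (g : R -> R) (C : R) :
  (forall u v, Rabs (g u - g v) <= C * Rabs (u - v)) ->
  forall x, continuous g x.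
Proof.
intros H x. apply filterlim_locally. intros eps.
(* [C] carries no sign; [Rmax C 1] is positive and still a Lipschitz constant. *)
assert (HC : 0 < Rmax C 1) by (generalize (Rmax_r C 1); lra).
assert (He : 0 < eps / Rmax C 1) by (apply Rdiv_lt_0_compat; [apply cond_pos | easy]).
exists (mkposreal _ He). intros y Hy.
change (Rabs (y - x) < eps / Rmax C 1) in Hy.
change (Rabs (g y - g x) < eps).
apply Rle_lt_trans with (Rmax C 1 * Rabs (y - x)).
- eapply Rle_trans; [apply H |].
  apply Rmult_le_compat_r; [apply Rabs_pos | apply Rmax_l].
- replace (pos eps) with (Rmax C 1 * (eps / Rmax C 1)) by (field; lra).
  now apply Rmult_lt_compat_l.
Qed.

Lemma continuous_div (f g : R -> R) (x : R) :
  continuous f x -> continuous g x -> g x <> 0 -> continuous (fun y => f y / g y) x.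
Proof.
intros Hf Hg H. apply (continuous_mult f (fun y => / g y)); [easy |].
now apply continuous_Rinv_comp.
Qed.

Lemma ex_RInt_everywhere_continuous (f : R -> R) (a b : R) :
  (forall x, continuous f x) -> ex_RInt f a b.
Proof. intros H. apply (ex_RInt_continuous (V := R_CompleteNormedModule)). auto. Qed.

Lemma is_derive_RInt_continuous (f : R -> R) (a x : R) :
  (forall x, continuous f x) -> is_derive (fun y => RInt f a y) x (f x).
Proof.
intros H. apply (is_derive_RInt f (fun y => RInt f a y) a x); [| apply H].
apply filter_forall. intros y. apply (RInt_correct (V := R_CompleteNormedModule)).
now apply ex_RInt_everywhere_continuous.
Qed.

Lemma RInt_primitive (g G : R -> R) (a z : R) :
  (forall x, continuous g x) -> (forall x, is_derive G x (g x)) ->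
  RInt g a z = G z - G a.
Proof. intros Hg HG. apply is_RInt_unique. now apply (is_RInt_derive G g). Qed.

(** With the primitive of the majorant given explicitly, the integral estimates below reduce to a
    pointwise bound and a derivative check. *)
Lemma RInt_le_primitive (f g G : R -> R) (a z : R) :
  a <= z -> (forall x, continuous f x) -> (forall x, continuous g x) ->
  (forall x, is_derive G x (g x)) -> (forall x, a <= x <= z -> f x <= g x) ->
  RInt f a z <= G z - G a.
Proof.
intros Haz Hf Hg HG H. rewrite <- (RInt_primitive g G) by easy.
apply RInt_le; try easy; try now apply ex_RInt_everywhere_continuous.
intros x Hx. apply H. lra.
Qed.

Lemma RInt_ge_primitive (f g G : R -> R) (a z : R) :
  a <= z -> (forall x, continuous f x) -> (forall x, continuous g x) ->
  (forall x, is_derive G x (g x)) -> (forall x, a <= x <= z -> g x <= f x) ->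
  G z - G a <= RInt f a z.
Proof.
intros Haz Hf Hg HG H. rewrite <- (RInt_primitive g G) by easy.
apply RInt_le; try easy; try now apply ex_RInt_everywhere_continuous.
intros x Hx. apply H. lra.
Qed.

Lemma RInt_diff_le_primitive (f1 f2 g G : R -> R) (a z : R) :
  a <= z -> (forall x, continuous f1 x) -> (forall x, continuous f2 x) ->
  (forall x, continuous g x) ->
  (forall x, is_derive G x (g x)) -> (forall x, a <= x <= z -> Rabs (f1 x - f2 x) <= g x) ->
  Rabs (RInt f1 a z - RInt f2 a z) <= G z - G a.
Proof.
intros Haz H1 H2 Hg HG H.
assert (Hd : forall x, continuous (fun x => f1 x - f2 x) x)
  by (intros x; now apply (continuous_minus f1 f2)).
assert (E : RInt f1 a z - RInt f2 a z = RInt (fun x => f1 x - f2 x) a z).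
{ symmetry. apply (RInt_minus f1 f2); now apply ex_RInt_everywhere_continuous. }
rewrite E. apply Rabs_le. split.
- assert (L : - G z - - G a <= RInt (fun x => f1 x - f2 x) a z); [| lra].
  apply (RInt_ge_primitive _ (fun x => - g x) (fun x => - G x)); try easy.
  + intros x. now apply (continuous_opp g).
  + intros x. now apply (is_derive_opp G).
  + intros x Hx. specialize (H x Hx). apply Rabs_le_between in H. lra.
- apply (RInt_le_primitive _ g G); try easy.
  intros x Hx. specialize (H x Hx). apply Rabs_le_between in H. lra.
Qed.

Lemma lipschitz_of_derive (h h' : R -> R) (a b C : R) :
  (forall x, is_derive h x (h' x)) -> (forall x, a <= x <= b -> Rabs (h' x) <= C) ->
  forall x y, a <= x <= b -> a <= y <= b -> Rabs (h x - h y) <= C * Rabs (x - y).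
Proof.
intros Hd Hb x y Hx Hy.
destruct (MVT_gen h y x h') as (c & Hc & ->).
- intros; apply Hd.
- intros z _. apply continuity_pt_filterlim.
  apply (ex_derive_continuous h). eexists; apply Hd.
- rewrite Rabs_mult. apply Rmult_le_compat_r; [apply Rabs_pos |].
  apply Hb. revert Hc. unfold Rmin, Rmax. destruct (Rle_dec y x); lra.
Qed.

Lemma exp_le (x y : R) : x <= y -> exp x <= exp y.
Proof. intros [H | ->]; [left; now apply exp_increasing | apply Rle_refl]. Qed.

Lemma exp_ge_1 (x : R) : 0 <= x -> 1 <= exp x.
Proof. rewrite <- exp_0. apply exp_le. Qed.

Lemma exp_lipschitz (c x y : R) :
  x <= c -> y <= c -> Rabs (exp x - exp y) <= exp c * Rabs (x - y).
Proof.
intros Hx Hy.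
apply (lipschitz_of_derive exp exp (Rmin x y) c).
- intros; apply is_derive_exp.
- intros z Hz. rewrite Rabs_pos_eq by (left; apply exp_pos). apply exp_le; lra.
- split; [apply Rmin_l | easy].
- split; [apply Rmin_r | easy].
Qed.

Lemma Rdiv_le_compat (p p' q q' : R) :
  0 <= p <= p' -> 0 < q' <= q -> p / q <= p' / q'.
Proof.
intros Hp Hq. apply Rmult_le_compat; try lra.
- left; apply Rinv_0_lt_compat; lra.
- apply Rinv_le_contravar; lra.
Qed.

(** Splits the difference as (p - p') / q + p' (q' - q) / (q q'). With m = [Lm] or m = 1 this
    produces the shape of the constants [D1] to [D4]. *)
Lemma Rdiv_dist (p q p' q' m P da db : R) :
  0 < m -> m <= q -> m <= q' -> 0 <= p' <= P ->
  Rabs (p - p') <= da -> Rabs (q - q') <= db ->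
  Rabs (p / q - p' / q') <= (P * db + m * da) / m ^ 2.
Proof.
intros Hm Hq Hq' Hp Ha Hb.
replace (p / q - p' / q') with ((p - p') * / q + p' * (q' - q) * (/ q * / q')) by (field; lra).
replace ((P * db + m * da) / m ^ 2) with (da * / m + P * db * (/ m * / m)) by (field; lra).
assert (Iq : 0 < / q <= / m).
{ split; [apply Rinv_0_lt_compat; lra | apply Rinv_le_contravar; lra]. }
assert (Iq' : 0 < / q' <= / m).
{ split; [apply Rinv_0_lt_compat; lra | apply Rinv_le_contravar; lra]. }
eapply Rle_trans; [apply Rabs_triang |].
apply Rplus_le_compat; rewrite Rabs_mult.
- apply Rmult_le_compat; try apply Rabs_pos; [easy |]. rewrite Rabs_pos_eq; lra.
- apply Rmult_le_compat; try apply Rabs_pos.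
  + rewrite Rabs_mult, (Rabs_pos_eq p') by lra. rewrite Rabs_minus_sym.
    apply Rmult_le_compat; try lra. apply Rabs_pos.
  + rewrite Rabs_pos_eq; [apply Rmult_le_compat |]; try lra.
    apply Rmult_le_pos; lra.
Qed.

(** The weight p' / q' lies in [0, 1] and absorbs the second denominator, so a single power of 1 / q
    remains. The contraction estimate relies on this, since its errors are proportional to lam only
    once. *)
Lemma Rdiv_dist_fraction (p q p' q' da db : R) :
  0 < q -> 0 <= p' <= q' -> 0 < q' -> Rabs (p - p') <= da -> Rabs (q - q') <= db ->
  Rabs (p / q - p' / q') <= (da + db) / q.
Proof.
intros Hq Hp Hq' Ha Hb.
replace (p / q - p' / q') with (((p - p') + p' / q' * (q' - q)) / q) by (field; lra).
unfold Rdiv at 1 3. rewrite Rabs_mult, (Rabs_pos_eq (/ q)) by (left; now apply Rinv_0_lt_compat).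
apply Rmult_le_compat_r; [left; now apply Rinv_0_lt_compat |].
eapply Rle_trans; [apply Rabs_triang |]. apply Rplus_le_compat; [easy |].
rewrite Rabs_mult, Rabs_minus_sym.
assert (0 <= p' / q' <= 1).
{ split; [apply Rdiv_le_0_compat; lra |].
  apply Rmult_le_reg_r with q'; [easy |]. unfold Rdiv. rewrite Rmult_assoc, Rinv_l; lra. }
rewrite (Rabs_pos_eq (p' / q')) by lra.
rewrite <- (Rmult_1_l db). apply Rmult_le_compat; try lra. apply Rabs_pos.
Qed.

(** * Geometric decay and the contraction principle for continuous functions on the line *)

Lemma le_geom_eq_0 (x C q : R) :
  0 <= q < 1 -> (forall n, Rabs x <= C * q ^ n) -> x = 0.
Proof.
intros Hq H. apply Rabs_eq_0, Rle_antisym; [| apply Rabs_pos].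
change (Rbar_le (Rabs x) 0).
apply (is_lim_seq_le (fun _ => Rabs x) (fun n => C * q ^ n) _ _ H).
- apply is_lim_seq_const.
- replace (Finite 0) with (Rbar_mult C 0) by (simpl; now rewrite Rmult_0_r).
  apply (is_lim_seq_scal_l (fun n => q ^ n) C 0). apply is_lim_seq_geom.
  rewrite Rabs_pos_eq; lra.
Qed.

Lemma geom_eventually_small (C q e : R) :
  0 <= q < 1 -> 0 < e -> exists n, forall k, (n <= k)%nat -> C * q ^ k < e.
Proof.
intros Hq He.
assert (L : is_lim_seq (fun n => C * q ^ n) 0).
{ replace (Finite 0) with (Rbar_mult C 0) by (simpl; now rewrite Rmult_0_r).
  apply (is_lim_seq_scal_l (fun n => q ^ n) C 0). apply is_lim_seq_geom.
  rewrite Rabs_pos_eq; lra. }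
apply is_lim_seq_spec in L. destruct (L (mkposreal e He)) as [n Hn].
exists n. intros k Hk. specialize (Hn k Hk). simpl in Hn.
rewrite Rminus_0_r in Hn. eapply Rle_lt_trans; [apply Rle_abs | exact Hn].
Qed.

(** The hypothesis applied to the supremum M of |h| gives M <= q M + c; the a priori bound [B] makes
    M finite. *)
Lemma sup_contraction (h : R -> R) (B q c : R) :
  0 <= q < 1 -> (forall x, Rabs (h x) <= B) ->
  (forall e, (forall x, Rabs (h x) <= e) -> forall x, Rabs (h x) <= q * e + c) ->
  forall x, Rabs (h x) <= c / (1 - q).
Proof.
intros Hq HB Hc.
destruct (completeness (fun y => exists x, y = Rabs (h x))) as [M [M1 M2]].
- exists B. intros y [x ->]. apply HB.
- exists (Rabs (h 0)). now exists 0.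
- assert (HM : forall x, Rabs (h x) <= M) by (intros x; apply M1; now exists x).
  assert (M <= q * M + c) by (apply M2; intros y [x ->]; now apply Hc).
  intros x. apply Rle_trans with M; [easy |].
  apply Rmult_le_reg_r with (1 - q); [lra |].
  unfold Rdiv. rewrite Rmult_assoc, Rinv_l; lra.
Qed.

Lemma banach_continuous (K : (R -> R) -> R -> R) (q : R) :
  0 <= q < 1 ->
  (forall f, (forall x, continuous f x) -> forall x, continuous (K f) x) ->
  (forall f, (forall x, continuous f x) -> forall x, Rabs (K f x) <= 1) ->
  (forall f g e, (forall x, continuous f x) -> (forall x, continuous g x) ->
     (forall x, Rabs (f x - g x) <= e) -> forall x, Rabs (K f x - K g x) <= q * e) ->
  exists f, (forall x, continuous f x) /\ forall x, f x = K f x.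
Proof.
intros Hq Kc Kb Kq.
set (F := fix F n := match n with O => fun _ => 0 | S n => K (F n) end).
assert (Fc : forall n x, continuous (F n) x).
{ induction n; simpl; [intros; apply continuous_const | now apply Kc]. }
assert (Fb : forall n x, Rabs (F n x) <= 1).
{ intros [| n] x; simpl; [rewrite Rabs_R0; lra | now apply Kb]. }
(* Induction on n with m free: the base case compares [F m] with the zero function, and each step
   gains a factor q from [Kq]. *)
assert (FC : forall n m x, Rabs (F (n + m)%nat x - F n x) <= 2 * q ^ n).
{ induction n; intros m x; simpl.
  - eapply Rle_trans; [apply Rabs_triang |]. rewrite Rabs_Ropp, Rabs_R0.
    generalize (Fb m x); lra.
  - replace (2 * (q * q ^ n)) with (q * (2 * q ^ n)) by ring. now apply Kq. }
assert (FL : forall x, ex_finite_lim_seq (fun n => F n x)).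
{ intros x. apply ex_lim_seq_cauchy_corr. intros eps.
  (* 4 is twice the constant of [FC]: both terms are compared with the one of index N. *)
  destruct (geom_eventually_small 4 q eps Hq (cond_pos eps)) as [N HN].
  exists N. intros n m Hn Hm.
  assert (A1 := FC N (n - N)%nat x). assert (A2 := FC N (m - N)%nat x).
  replace (N + (n - N))%nat with n in A1 by lia.
  replace (N + (m - N))%nat with m in A2 by lia.
  specialize (HN N (Nat.le_refl _)).
  apply Rabs_le_between in A1. apply Rabs_le_between in A2.
  apply Rabs_def1; lra. }
set (f := fun x => real (Lim_seq (fun n => F n x))).
assert (Ff : forall n x, Rabs (f x - F n x) <= 2 * q ^ n).
{ intros n x.
  assert (L : is_lim_seq (fun m => Rabs (F (n + m)%nat x - F n x)) (Rabs (f x - F n x))).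
  { apply (is_lim_seq_abs _ (Finite _)). apply is_lim_seq_minus'; [| apply is_lim_seq_const].
    apply (is_lim_seq_ext (fun m => F (m + n)%nat x)).
    - intros m. now rewrite Nat.add_comm.
    - apply (is_lim_seq_incr_n (fun m => F m x) n). apply Lim_seq_correct', FL. }
  apply (is_lim_seq_le _ (fun _ => 2 * q ^ n) (Rabs (f x - F n x)) (2 * q ^ n) (fun m => FC n m x) L).
  apply is_lim_seq_const. }
assert (fc : forall x, continuous f x).
{ intros x. apply filterlim_locally. intros eps.
  assert (He : 0 < eps / 2) by (generalize (cond_pos eps); lra).
  (* Uniform limit of continuous functions: 2 q^n + eps / 2 + 2 q^n < eps. *)
  destruct (geom_eventually_small 4 q (eps / 2) Hq He) as [n Hn].
  specialize (Hn n (Nat.le_refl _)).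
  generalize (proj1 (filterlim_locally _ _) (Fc n x) (mkposreal _ He)).
  apply filter_imp. intros y Hy.
  change (Rabs (F n y - F n x) < eps / 2) in Hy.
  change (Rabs (f y - f x) < eps).
  assert (A1 := Ff n x). assert (A2 := Ff n y).
  apply Rabs_le_between in A1. apply Rabs_le_between in A2. apply Rabs_def2 in Hy.
  apply Rabs_def1; lra. }
exists f. split; [easy |].
intros x. apply Rminus_diag_uniq.
(* Both f and K f lie within 2 q^(n+1) of the iterate n + 1. *)
apply (le_geom_eq_0 _ 4 q Hq). intros n.
assert (A1 := Ff (S n) x).
assert (A2 := Kq f (F n) (2 * q ^ n) fc (Fc n) (Ff n) x).
change (K (F n) x) with (F (S n) x) in A2.
simpl pow in A1. apply Rabs_le_between in A1. apply Rabs_le_between in A2.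
assert (0 <= q ^ n) by (apply pow_le; lra).
assert (q * q ^ n <= q ^ n) by nra.
apply Rabs_le. lra.
Qed.

(* A function on [[0, lam]] is extended to the line by its end values, so that all
   iterates are continuous on [R]. *)
Definition clamp (lam x : R) : R := Rmax 0 (Rmin x lam).

Ltac clamp_cases :=
  intros; unfold clamp, Rmax, Rmin, Rabs in *;
  repeat match goal with
  | |- context [Rle_dec ?x ?y] => destruct (Rle_dec x y)
  | |- context [Rcase_abs ?x] => destruct (Rcase_abs x)
  | H : context [Rle_dec ?x ?y] |- _ => destruct (Rle_dec x y)
  end; lra.

Lemma clamp_bounds (lam x : R) : 0 <= lam -> 0 <= clamp lam x <= lam.
Proof. clamp_cases. Qed.

Lemma clamp_id (lam x : R) : 0 <= x <= lam -> clamp lam x = x.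
Proof. clamp_cases. Qed.

Lemma clamp_lam_dist (lam lam' x : R) :
  Rabs (clamp lam x - clamp lam' x) <= Rabs (lam - lam').
Proof. clamp_cases. Qed.

Lemma clamp_dist (lam x y : R) : Rabs (clamp lam x - clamp lam y) <= Rabs (x - y).
Proof. clamp_cases. Qed.

Lemma continuous_clamp (lam x : R) : continuous (clamp lam) x.
Proof.
apply (lipschitz_continuous _ 1). intros u v. rewrite Rmult_1_l. apply clamp_dist.
Qed.

(** Clamping the argument of [Phi] keeps the integrals inside [0, lam], so the operator reads f on
    that interval only, yet returns a function on the whole line. *)
Definition solution_operator (d : data) (lam : R) (f : R -> R) (x : R) : R :=
  (1 + 2 * Bi d * Phi d f (clamp lam x)) / (1 + 2 * Bi d * Phi d f lam).

(** The filter [within P] covers [at_right] and [at_left] at once. Agreement with a differentiable G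
    on one side is all that can be asked, since the clamped profile has a kink at 0 and at lam. *)
Lemma one_sided_derive (P : R -> Prop) (g G : R -> R) (a l r : R) :
  0 < r -> is_derive G a l -> g a = G a ->
  (forall y, P y -> y <> a) -> (forall y, P y -> Rabs (y - a) < r -> g y = G y) ->
  filterlim (fun y => (g y - g a) / (y - a)) (within P (locally a)) (locally l).
Proof.
intros Hr HG Ha HP Hg. apply filterlim_locally. intros eps.
apply is_derive_Reals in HG. destruct (HG eps (cond_pos eps)) as [e He].
assert (H0 : 0 < Rmin e r) by (apply Rmin_pos; [apply cond_pos | easy]).
exists (mkposreal _ H0). intros y Hy Py.
change (Rabs (y - a) < Rmin e r) in Hy.
change (Rabs ((g y - g a) / (y - a) - l) < eps).
rewrite Ha, Hg; [| easy |].
- replace (G y) with (G (a + (y - a))) by (f_equal; ring). apply He.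
  + specialize (HP y Py). lra.
  + eapply Rlt_le_trans; [exact Hy | apply Rmin_l].
- eapply Rlt_le_trans; [exact Hy | apply Rmin_r].
Qed.

Lemma sqrt_mul_pos (a t : R) : 0 < a -> 0 < t -> 0 < sqrt (a * t).
Proof. intros. now apply sqrt_lt_R0, Rmult_lt_0_compat. Qed.

Lemma is_derive_similarity_variable (a x t : R) : 0 < a -> 0 < t ->
  is_derive (fun tau => x / (2 * sqrt (a * tau))) t (- (x / (2 * sqrt (a * t))) / (2 * t)).
Proof.
intros Ha Ht. assert (Hs := sqrt_mul_pos a t Ha Ht).
assert (Hat : 0 < a * t) by now apply Rmult_lt_0_compat.
assert (H2 : sqrt (a * t) * sqrt (a * t) = a * t) by (apply sqrt_sqrt; lra).
evar_last.
- apply (is_derive_ext (fun tau => x / 2 * / sqrt (a * tau))).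
  + intros tau. simpl. unfold Rdiv. rewrite Rinv_mult. lra.
  + apply (is_derive_scal (fun tau => / sqrt (a * tau)) t (x / 2)).
    apply (is_derive_inv (fun tau => sqrt (a * tau))); [| lra].
    apply (is_derive_comp sqrt (fun tau => a * tau)).
    * apply is_derive_Reals, derivable_pt_lim_sqrt. easy.
    * auto_derive; [easy | reflexivity].
- unfold scal; simpl; unfold mult; simpl.
  (* Eliminating a through a = s^2 / t leaves a rational identity in s, t and x. *)
  set (s := sqrt (a * t)) in *. replace a with (s * s / t) by (rewrite H2; field; lra).
  field. lra.
Qed.

Lemma erf_pos (x : R) : 0 < x -> 0 < erf x.
Proof.
intros Hx. apply Rmult_lt_0_compat.
- apply Rdiv_lt_0_compat; [lra | apply sqrt_lt_R0, PI_RGT_0].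
- apply RInt_gt_0; [easy | intros; apply exp_pos |].
  intros y _. apply (ex_derive_continuous (fun u => exp (- u ^ 2))). now auto_derive.
Qed.

(** * The nonlinear operators *)

Section Stefan.

Context (d : data) (b : bounds).
Context (hd : positive_data d) (hb : positive_bounds b).
Context (hK : hyp_K d b) (hR : hyp_R d b) (hV : hyp_V d b).

Local Notation Lm := (L_m d b).
Local Notation LM := (L_M d b).
Local Notation Lt := (L_t d b).
Local Notation Nm := (N_m d b).
Local Notation NM := (N_M d b).
Local Notation Nt := (N_t d b).
Local Notation muM := (mu_M d b).
Local Notation mut := (mu_t d b).
Local Notation cont f := (forall x : R, continuous f x).

Lemma sqrt_rho0c0k0_pos : 0 < sqrt (rho0 d * c0 d * k0 d).
Proof.
destruct hd as (h1 & h2 & h3 & h4 & h5 & h6).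
apply sqrt_lt_R0. repeat apply Rmult_lt_0_compat; easy.
Qed.

Lemma dimensionless_pos :
  0 < Lm /\ 0 < LM /\ 0 < Lt /\ 0 < Nm /\ 0 < NM /\ 0 < Nt /\ 0 < muM /\ 0 < mut.
Proof.
destruct hd as (h1 & h2 & h3 & h4 & h5 & h6).
destruct hb as (b1 & b2 & b3 & b4 & b5 & b6 & b7 & b8 & b9).
assert (hs := sqrt_rho0c0k0_pos).
assert (0 < rho0 d * c0 d) by now apply Rmult_lt_0_compat.
assert (0 < Tstar d - Tm d) by lra.
repeat split; apply Rdiv_lt_0_compat; try easy; now apply Rmult_lt_0_compat.
Qed.

Lemma Bi_pos : 0 < Bi d.
Proof.
destruct hd as (h1 & h2 & h3 & h4 & h5 & h6).
apply Rdiv_lt_0_compat; [| easy]. apply Rmult_lt_0_compat; [easy |].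
apply sqrt_lt_R0, Rdiv_lt_0_compat; [easy | now apply Rmult_lt_0_compat].
Qed.

Lemma Ste_pos : 0 < Ste d.
Proof.
destruct hd as (h1 & h2 & h3 & h4 & h5 & h6).
apply Rdiv_lt_0_compat; [| easy]. apply Rmult_lt_0_compat; lra.
Qed.

(** Common source of the constants for L, N and mu: [temp] is affine in f with slope [Tm - Tstar],
    whence the factor [Tstar - Tm] in the Lipschitz constants. *)
Lemma scaled_bounds (g : R -> R) (lo hi lip s : R) :
  0 < s -> bounded_lipschitz g lo hi lip ->
  (forall f x, lo / s <= g (temp d f x) / s <= hi / s) /\
  (forall f1 f2 x, Rabs (g (temp d f1 x) / s - g (temp d f2 x) / s) <=
     lip * (Tstar d - Tm d) / s * Rabs (f1 x - f2 x)).
Proof.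
intros Hs H. destruct (bounded_lipschitz_pointwise _ _ _ _ H) as [Hb Hl].
assert (Hi : 0 <= / s) by (left; now apply Rinv_0_lt_compat).
split.
- intros f x. split; apply Rmult_le_compat_r; try easy; apply Hb.
- intros f1 f2 x.
  replace (g (temp d f1 x) / s - g (temp d f2 x) / s)
    with ((g (temp d f1 x) - g (temp d f2 x)) * / s) by (unfold Rdiv; ring).
  rewrite Rabs_mult, (Rabs_pos_eq (/ s)) by easy.
  replace (lip * (Tstar d - Tm d) / s * Rabs (f1 x - f2 x))
    with (lip * ((Tstar d - Tm d) * Rabs (f1 x - f2 x)) * / s) by (unfold Rdiv; ring).
  apply Rmult_le_compat_r; [easy |]. eapply Rle_trans; [apply Hl |].
  right. f_equal. unfold temp.
  replace ((Tm d - Tstar d) * f1 x + Tstar d - ((Tm d - Tstar d) * f2 x + Tstar d))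
    with ((Tm d - Tstar d) * (f1 x - f2 x)) by ring.
  rewrite Rabs_mult, Rabs_minus_sym, (Rabs_pos_eq (Tstar d - Tm d)); [easy |].
  destruct hd; lra.
Qed.

Lemma Ls_bounds :
  (forall f x, Lm <= Ls d f x <= LM) /\
  (forall f g x, Rabs (Ls d f x - Ls d g x) <= Lt * Rabs (f x - g x)).
Proof.
destruct hd as (h1 & h2 & h3 & h4 & h5 & h6). now apply scaled_bounds.
Qed.

Lemma Ns_bounds :
  (forall f x, Nm <= Ns d f x <= NM) /\
  (forall f g x, Rabs (Ns d f x - Ns d g x) <= Nt * Rabs (f x - g x)).
Proof.
destruct hd as (h1 & h2 & h3 & h4 & h5 & h6).
apply (scaled_bounds (fun u => rhof d u * cf d u)); [now apply Rmult_lt_0_compat | easy].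
Qed.

Lemma mus_bounds :
  (forall f x, 0 <= mus d f x <= muM) /\
  (forall f g x, Rabs (mus d f x - mus d g x) <= mut * Rabs (f x - g x)).
Proof.
destruct (scaled_bounds _ _ _ _ _ sqrt_rho0c0k0_pos hV) as [H1 H2].
split; [| easy]. intros f x. split; [| apply H1].
eapply Rle_trans; [| apply H1]. left. apply Rdiv_lt_0_compat; [apply hb | apply sqrt_rho0c0k0_pos].
Qed.

Lemma Ls_pos (f : R -> R) (x : R) : 0 < Ls d f x.
Proof.
generalize (proj1 Ls_bounds f x) (proj1 dimensionless_pos); lra.
Qed.

(** The first and third hypotheses say that G f x depends on the number f x only, so G f is the
    composition of f with the Lipschitz map u |-> G (fun _ => u) 0. *)
Lemma continuous_of_dist (G : (R -> R) -> R -> R) (C : R) (f : R -> R) :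
  (forall f x y, f x = f y -> G f x = G f y) ->
  (forall f g x, Rabs (G f x - G g x) <= C * Rabs (f x - g x)) ->
  (forall f g x, f x = g x -> G f x = G g x) ->
  cont f -> cont (G f).
Proof.
intros Hxy Hl Hfg Hf x.
apply (continuous_ext (fun y => G (fun _ => f y) 0)).
- intros y. rewrite (Hxy (fun _ => f y) 0 y) by easy. now apply Hfg.
- apply (continuous_comp f (fun u => G (fun _ => u) 0)); [apply Hf |].
  apply (lipschitz_continuous _ C). intros u v. apply (Hl (fun _ => u) (fun _ => v) 0).
Qed.

Lemma continuous_Ls (f : R -> R) : cont f -> cont (Ls d f).
Proof.
apply continuous_of_dist with Lt; [| apply Ls_bounds |];
  intros; unfold Ls, temp; now rewrite H.
Qed.

Lemma continuous_Ns (f : R -> R) : cont f -> cont (Ns d f).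
Proof.
apply continuous_of_dist with Nt; [| apply Ns_bounds |];
  intros; unfold Ns, temp; now rewrite H.
Qed.

Lemma continuous_mus (f : R -> R) : cont f -> cont (mus d f).
Proof.
apply continuous_of_dist with mut; [| apply mus_bounds |];
  intros; unfold mus, temp; now rewrite H.
Qed.

Lemma continuous_mus_Ls (f : R -> R) : cont f -> cont (fun x => mus d f x / Ls d f x).
Proof.
intros Hf x. apply continuous_div; [now apply continuous_mus | now apply continuous_Ls |].
generalize (Ls_pos f x); lra.
Qed.

Lemma continuous_Ns_Ls (f : R -> R) : cont f -> cont (fun x => x * Ns d f x / Ls d f x).
Proof.
intros Hf x. apply continuous_div; [| now apply continuous_Ls | generalize (Ls_pos f x); lra].
apply (continuous_mult (fun x => x) (Ns d f)); [apply continuous_id | now apply continuous_Ns].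
Qed.

Lemma Ef_exp (f : R -> R) (z : R) :
  Ef d f z = exp (2 * RInt (fun x => mus d f x / Ls d f x) 0 z -
                  2 * RInt (fun x => x * Ns d f x / Ls d f x) 0 z).
Proof. unfold Ef, Uf, If, Rdiv at 1. unfold Rminus. rewrite exp_plus, exp_Ropp. easy. Qed.

Lemma Ef_pos (f : R -> R) (z : R) : 0 < Ef d f z.
Proof. rewrite Ef_exp. apply exp_pos. Qed.

(** The similarity form of the heat equation: for a fixed point, the flux is a constant multiple of
    [Ef]. *)
Lemma is_derive_Ef (f : R -> R) (z : R) : cont f ->
  is_derive (Ef d f) z
    (2 * ((mus d f z - z * Ns d f z) / Ls d f z) * Ef d f z).
Proof.
intros Hf. apply (is_derive_ext _ _ _ _ (fun t => eq_sym (Ef_exp f t))).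
rewrite Ef_exp. evar_last.
- apply (is_derive_comp exp); [apply is_derive_exp |].
  apply (is_derive_minus (V := R_NormedModule)); apply (is_derive_scal _ _ 2).
  + now apply is_derive_RInt_continuous, continuous_mus_Ls.
  + now apply is_derive_RInt_continuous, continuous_Ns_Ls.
- unfold scal, minus, plus, opp; simpl; unfold mult; simpl. unfold Rdiv. ring.
Qed.

Lemma continuous_Ef (f : R -> R) : cont f -> cont (Ef d f).
Proof.
intros Hf x. apply (ex_derive_continuous (Ef d f)). eexists. now apply is_derive_Ef.
Qed.

Lemma continuous_Ef_Ls (f : R -> R) : cont f -> cont (fun x => Ef d f x / Ls d f x).
Proof.
intros Hf x. apply continuous_div; [now apply continuous_Ef | now apply continuous_Ls |].
generalize (Ls_pos f x); lra.
Qed.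

Lemma is_derive_Phi (f : R -> R) (x : R) : cont f ->
  is_derive (Phi d f) x (Ef d f x / Ls d f x).
Proof.
intros Hf. apply (is_derive_RInt_continuous (fun z => Ef d f z / Ls d f z)).
now apply continuous_Ef_Ls.
Qed.

Lemma RInt_mus_Ls_bounds (f : R -> R) (z : R) : cont f -> 0 <= z ->
  0 <= RInt (fun x => mus d f x / Ls d f x) 0 z <= z * (muM / Lm).
Proof.
intros Hf Hz.
destruct dimensionless_pos as (p1 & p2 & p3 & p4 & p5 & p6 & p7 & p8).
split.
- apply RInt_ge_0; [easy | now apply ex_RInt_everywhere_continuous, continuous_mus_Ls |].
  intros x _. apply Rdiv_le_0_compat; [apply mus_bounds | apply Ls_pos].
- replace (z * (muM / Lm)) with (z * (muM / Lm) - 0 * (muM / Lm)) by ring.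
  apply (RInt_le_primitive _ (fun _ => muM / Lm) (fun z => z * (muM / Lm))); try easy.
  + now apply continuous_mus_Ls.
  + intros; apply continuous_const.
  + intros x. auto_derive; [easy | ring].
  + intros x _. apply Rdiv_le_compat; [apply mus_bounds |].
    split; [easy | apply Ls_bounds].
Qed.

Lemma RInt_Ns_Ls_bounds (f : R -> R) (z : R) : cont f -> 0 <= z ->
  z ^ 2 / 2 * (Nm / LM) <= RInt (fun x => x * Ns d f x / Ls d f x) 0 z
    <= z ^ 2 / 2 * (NM / Lm).
Proof.
intros Hf Hz.
destruct dimensionless_pos as (p1 & p2 & p3 & p4 & p5 & p6 & p7 & p8).
assert (HN := proj1 Ns_bounds f). assert (HL := proj1 Ls_bounds f).
assert (Hl : forall c x, is_derive (fun z => z ^ 2 / 2 * c) x (x * c))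
  by (intros c x; auto_derive; [easy | field]).
assert (Hc : forall c x, continuous (fun z => z * c) x)
  by (intros c x; apply (ex_derive_continuous (fun z => z * c)); now auto_derive).
split.
- set (c := Nm / LM). replace (z ^ 2 / 2 * c) with (z ^ 2 / 2 * c - 0 ^ 2 / 2 * c) by field. unfold c.
  apply (RInt_ge_primitive _ (fun x => x * (Nm / LM)) (fun z => z ^ 2 / 2 * (Nm / LM))); try easy.
  + now apply continuous_Ns_Ls.
  + intros x Hx. unfold Rdiv at 2. rewrite Rmult_assoc. apply Rmult_le_compat_l; [easy |].
    apply Rdiv_le_compat; [specialize (HN x); lra |].
    split; [apply Ls_pos | apply HL].
- set (c := NM / Lm). replace (z ^ 2 / 2 * c) with (z ^ 2 / 2 * c - 0 ^ 2 / 2 * c) by field. unfold c.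
  apply (RInt_le_primitive _ (fun x => x * (NM / Lm)) (fun z => z ^ 2 / 2 * (NM / Lm))); try easy.
  + now apply continuous_Ns_Ls.
  + intros x Hx. unfold Rdiv at 1. rewrite Rmult_assoc. apply Rmult_le_compat_l; [easy |].
    apply Rdiv_le_compat; [specialize (HN x); lra |].
    split; [easy | apply HL].
Qed.

Lemma Ef_lower (f : R -> R) (z : R) : cont f -> 0 <= z ->
  exp (- (NM / Lm * z ^ 2)) <= Ef d f z.
Proof.
intros Hf Hz. rewrite Ef_exp. apply exp_le.
generalize (RInt_mus_Ls_bounds f z Hf Hz) (RInt_Ns_Ls_bounds f z Hf Hz). lra.
Qed.

(** The exponent is the one in [V2]. The weaker [Ef_upper] drops the N term and gives the
    exponential in [D4]. *)
Lemma Ef_upper_sharp (f : R -> R) (z : R) : cont f -> 0 <= z ->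
  Ef d f z <= exp (2 * z * muM / Lm - z ^ 2 * Nm / LM).
Proof.
intros Hf Hz. rewrite Ef_exp. apply exp_le.
generalize (RInt_mus_Ls_bounds f z Hf Hz) (RInt_Ns_Ls_bounds f z Hf Hz). unfold Rdiv. lra.
Qed.

Lemma Ef_upper (f : R -> R) (z : R) : cont f -> 0 <= z ->
  Ef d f z <= exp (2 * z * (muM / Lm)).
Proof.
intros Hf Hz. eapply Rle_trans; [now apply Ef_upper_sharp |]. apply exp_le.
destruct dimensionless_pos as (p1 & p2 & p3 & p4 & p5 & p6 & p7 & p8).
assert (0 <= z ^ 2 * Nm / LM).
{ apply Rdiv_le_0_compat; [| easy]. apply Rmult_le_pos; [apply pow2_ge_0 | lra]. }
unfold Rdiv in *. lra.
Qed.

Lemma Phi_ge_0 (f : R -> R) (z : R) : cont f -> 0 <= z -> 0 <= Phi d f z.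
Proof.
intros Hf Hz. apply RInt_ge_0; [easy | now apply ex_RInt_everywhere_continuous, continuous_Ef_Ls |].
intros x _. left. apply Rdiv_lt_0_compat; [apply Ef_pos | apply Ls_pos].
Qed.

Lemma Phi_le (f : R -> R) (x y : R) : cont f -> x <= y -> Phi d f x <= Phi d f y.
Proof.
intros Hf Hxy.
assert (E : Phi d f y - Phi d f x = RInt (fun z => Ef d f z / Ls d f z) x y).
{ symmetry. apply (RInt_primitive (fun z => Ef d f z / Ls d f z)); [now apply continuous_Ef_Ls |].
  intros t. now apply is_derive_Phi. }
assert (0 <= RInt (fun z => Ef d f z / Ls d f z) x y); [| lra].
apply RInt_ge_0; [easy | now apply ex_RInt_everywhere_continuous, continuous_Ef_Ls |].
intros z _. left. apply Rdiv_lt_0_compat; [apply Ef_pos | apply Ls_pos].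
Qed.

(** The lower bound of [Ef] is frozen at the endpoint z, where it is smallest. The linear growth in
    z is what the contraction estimate needs. *)
Lemma Phi_lower (f : R -> R) (z : R) : cont f -> 0 <= z ->
  z * (exp (- (NM / Lm * z ^ 2)) / LM) <= Phi d f z.
Proof.
intros Hf Hz.
destruct dimensionless_pos as (p1 & p2 & p3 & p4 & p5 & p6 & p7 & p8).
set (c := exp (- (NM / Lm * z ^ 2)) / LM).
replace (z * c) with (z * c - 0 * c) by ring.
apply (RInt_ge_primitive _ (fun _ => c) (fun z => z * c)); try easy.
- now apply continuous_Ef_Ls.
- intros; apply continuous_const.
- intros x. auto_derive; [easy | ring].
- intros x Hx. apply Rdiv_le_compat; [| split; [apply Ls_pos | apply Ls_bounds]].
  split; [left; apply exp_pos |].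
  eapply Rle_trans; [| now apply Ef_lower]. apply exp_le, Ropp_le_contravar.
  apply Rmult_le_compat_l; [left; now apply Rdiv_lt_0_compat |].
  apply pow_incr; lra.
Qed.

(** Here the Gaussian lower bound of [Ef] is integrated exactly, by the substitution u = r x with
    r^2 = NM / Lm; this is the source of the error function in [V2]. *)
Lemma Phi_lower_erf (f : R -> R) (z : R) : cont f -> 0 <= z ->
  sqrt PI / 2 * erf (sqrt (NM / Lm) * z) / (sqrt (NM / Lm) * LM) <= Phi d f z.
Proof.
intros Hf Hz.
destruct dimensionless_pos as (p1 & p2 & p3 & p4 & p5 & p6 & p7 & p8).
set (r := sqrt (NM / Lm)).
assert (Hr : 0 < r) by (apply sqrt_lt_R0; now apply Rdiv_lt_0_compat).
assert (Hr2 : r ^ 2 = NM / Lm).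
{ unfold r. simpl. rewrite Rmult_1_r. apply sqrt_sqrt. left; now apply Rdiv_lt_0_compat. }
assert (HPI : 0 < sqrt PI) by apply sqrt_lt_R0, PI_RGT_0.
assert (Hc : forall x, continuous (fun u => exp (- u ^ 2)) x)
  by (intros x; apply (ex_derive_continuous (fun u => exp (- u ^ 2))); now auto_derive).
set (G := fun y => RInt (fun u => exp (- u ^ 2)) 0 (r * y) / (r * LM)).
replace (sqrt PI / 2 * erf (r * z) / (r * LM)) with (G z - G 0).
- apply (RInt_ge_primitive _ (fun x => exp (- (r * x) ^ 2) / LM)); try easy.
  + now apply continuous_Ef_Ls.
  + intros x; apply (ex_derive_continuous (fun u => exp (- (r * u) ^ 2) / LM)).
    auto_derive. easy.
  + intros x. unfold G. evar_last.
    * apply (is_derive_ext (fun y => / (r * LM) * RInt (fun u => exp (- u ^ 2)) 0 (r * y))).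
      { intros t. unfold Rdiv. apply Rmult_comm. }
      apply (is_derive_scal _ _ (/ (r * LM))).
      apply (is_derive_comp (RInt (fun u => exp (- u ^ 2)) 0) (fun y => r * y)).
      { now apply is_derive_RInt_continuous. }
      auto_derive; [easy | reflexivity].
    * unfold scal; simpl; unfold mult; simpl. field. lra.
  + intros x Hx. apply Rdiv_le_compat; [| split; [apply Ls_pos | apply Ls_bounds]].
    split; [left; apply exp_pos |].
    eapply Rle_trans; [| now apply Ef_lower]. right. f_equal. rewrite <- Hr2. ring.
- unfold G, erf. rewrite Rmult_0_r, RInt_point. unfold zero; simpl. field. lra.
Qed.

(** * Lipschitz estimates *)

Lemma mus_Ls_dist (f g : R -> R) (x e : R) : Rabs (f x - g x) <= e ->
  Rabs (mus d f x / Ls d f x - mus d g x / Ls d g x) <=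
  (muM * Lt + Lm * mut) / Lm ^ 2 * e.
Proof.
intros He.
destruct dimensionless_pos as (p1 & p2 & p3 & p4 & p5 & p6 & p7 & p8).
replace ((muM * Lt + Lm * mut) / Lm ^ 2 * e)
  with ((muM * (Lt * e) + Lm * (mut * e)) / Lm ^ 2) by (field; lra).
apply Rdiv_dist; try easy; try apply Ls_bounds; try apply mus_bounds.
- eapply Rle_trans; [apply mus_bounds |]. apply Rmult_le_compat_l; lra.
- eapply Rle_trans; [apply Ls_bounds |]. apply Rmult_le_compat_l; lra.
Qed.

Lemma Ns_Ls_dist (f g : R -> R) (x e : R) : 0 <= x -> Rabs (f x - g x) <= e ->
  Rabs (x * Ns d f x / Ls d f x - x * Ns d g x / Ls d g x) <=
  x * ((NM * Lt + Lm * Nt) / Lm ^ 2 * e).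
Proof.
intros Hx He.
destruct dimensionless_pos as (p1 & p2 & p3 & p4 & p5 & p6 & p7 & p8).
replace (x * Ns d f x / Ls d f x - x * Ns d g x / Ls d g x)
  with (x * (Ns d f x / Ls d f x - Ns d g x / Ls d g x)) by (unfold Rdiv; ring).
rewrite Rabs_mult, Rabs_pos_eq by easy. apply Rmult_le_compat_l; [easy |].
replace ((NM * Lt + Lm * Nt) / Lm ^ 2 * e)
  with ((NM * (Lt * e) + Lm * (Nt * e)) / Lm ^ 2) by (field; lra).
assert (HN := proj1 Ns_bounds g x).
apply Rdiv_dist; try easy; try apply Ls_bounds; try lra.
- eapply Rle_trans; [apply Ns_bounds |]. apply Rmult_le_compat_l; lra.
- eapply Rle_trans; [apply Ls_bounds |]. apply Rmult_le_compat_l; lra.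
Qed.

(** Origin of [D1]: both exponents are at most 2 z muM / Lm, where [exp] has the Lipschitz constant
    appearing in [D1], and they differ by at most 2 z times the Lipschitz constant of mu / L times
    e. *)
Lemma Uf_dist (f g : R -> R) (z e : R) : cont f -> cont g -> 0 <= z ->
  (forall x, 0 <= x <= z -> Rabs (f x - g x) <= e) ->
  Rabs (Uf d f z - Uf d g z) <= D1 d b z * e.
Proof.
intros Hf Hg Hz He.
destruct dimensionless_pos as (p1 & p2 & p3 & p4 & p5 & p6 & p7 & p8).
set (c := (muM * Lt + Lm * mut) / Lm ^ 2 * e).
assert (HA : Rabs (RInt (fun x => mus d f x / Ls d f x) 0 z -
                   RInt (fun x => mus d g x / Ls d g x) 0 z) <= z * c).
{ replace (z * c) with (z * c - 0 * c) by ring.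
  apply (RInt_diff_le_primitive _ _ (fun _ => c) (fun z => z * c)); try easy.
  - now apply continuous_mus_Ls.
  - now apply continuous_mus_Ls.
  - intros; apply continuous_const.
  - intros x. auto_derive; [easy | ring].
  - intros x Hx. apply mus_Ls_dist. now apply He. }
unfold Uf. eapply Rle_trans.
- apply (exp_lipschitz (2 * (z * (muM / Lm)))); apply Rmult_le_compat_l; try lra;
    now apply RInt_mus_Ls_bounds.
- rewrite <- Rmult_minus_distr_l, Rabs_mult, (Rabs_pos_eq 2) by lra.
  apply Rle_trans with (exp (2 * (z * (muM / Lm))) * (2 * (z * c))).
  + apply Rmult_le_compat_l; [left; apply exp_pos |]. lra.
  + right. unfold D1, c.
    replace (2 * muM * z / Lm) with (2 * (z * (muM / Lm))) by (field; lra).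
    field. lra.
Qed.

(** As for [Uf_dist], but the factor x in the integrand integrates to z^2 / 2, which cancels the 2
    of the exponent: hence z^2 and no factor 2 in [D2]. *)
Lemma If_dist (f g : R -> R) (z e : R) : cont f -> cont g -> 0 <= z ->
  (forall x, 0 <= x <= z -> Rabs (f x - g x) <= e) ->
  Rabs (If d f z - If d g z) <= D2 d b z * e.
Proof.
intros Hf Hg Hz He.
destruct dimensionless_pos as (p1 & p2 & p3 & p4 & p5 & p6 & p7 & p8).
set (c := (NM * Lt + Lm * Nt) / Lm ^ 2 * e).
assert (HA : Rabs (RInt (fun x => x * Ns d f x / Ls d f x) 0 z -
                   RInt (fun x => x * Ns d g x / Ls d g x) 0 z) <= z ^ 2 / 2 * c).
{ replace (z ^ 2 / 2 * c) with (z ^ 2 / 2 * c - 0 ^ 2 / 2 * c) by field.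
  apply (RInt_diff_le_primitive _ _ (fun x => x * c) (fun z => z ^ 2 / 2 * c)); try easy.
  - now apply continuous_Ns_Ls.
  - now apply continuous_Ns_Ls.
  - intros x; apply (ex_derive_continuous (fun z => z * c)); now auto_derive.
  - intros x. auto_derive; [easy | field].
  - intros x Hx. apply Ns_Ls_dist; [easy | now apply He]. }
unfold If. eapply Rle_trans.
- apply (exp_lipschitz (2 * (z ^ 2 / 2 * (NM / Lm)))); apply Rmult_le_compat_l; try lra;
    now apply RInt_Ns_Ls_bounds.
- rewrite <- Rmult_minus_distr_l, Rabs_mult, (Rabs_pos_eq 2) by lra.
  apply Rle_trans with (exp (2 * (z ^ 2 / 2 * (NM / Lm))) * (2 * (z ^ 2 / 2 * c))).
  + apply Rmult_le_compat_l; [left; apply exp_pos |]. lra.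
  + right. unfold D2, c.
    replace (NM * z ^ 2 / Lm) with (2 * (z ^ 2 / 2 * (NM / Lm))) by (field; lra).
    field. lra.
Qed.

Lemma If_ge_1 (f : R -> R) (z : R) : cont f -> 0 <= z -> 1 <= If d f z.
Proof.
intros Hf Hz. rewrite <- exp_0. apply exp_le.
destruct dimensionless_pos as (p1 & p2 & p3 & p4 & p5 & p6 & p7 & p8).
assert (0 <= z ^ 2 / 2 * (Nm / LM)).
{ apply Rmult_le_pos; [generalize (pow2_ge_0 z); lra | left; now apply Rdiv_lt_0_compat]. }
generalize (RInt_Ns_Ls_bounds f z Hf Hz). lra.
Qed.

(** * Monotonicity of the constants and the root of [calE] = 1 *)

Lemma D1_mono (y z : R) : 0 <= y <= z -> 0 <= D1 d b y <= D1 d b z.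
Proof.
intros Hyz.
destruct dimensionless_pos as (p1 & p2 & p3 & p4 & p5 & p6 & p7 & p8).
assert (h : 0 < Lm ^ 2) by (apply pow_lt; lra).
assert (hc : 0 <= muM * Lt + Lm * mut) by (apply Rplus_le_le_0_compat; apply Rmult_le_pos; lra).
assert (hq : 0 < exp (2 * muM * y / Lm) <= exp (2 * muM * z / Lm)).
{ split; [apply exp_pos |]. apply exp_le. apply Rmult_le_compat_r; [left; now apply Rinv_0_lt_compat |].
  apply Rmult_le_compat_l; lra. }
assert (hi := Rinv_0_lt_compat _ h). unfold D1, Rdiv. split.
- repeat apply Rmult_le_pos; lra.
- apply Rmult_le_compat_r; [easy |]. apply Rmult_le_compat; try lra.
  + repeat apply Rmult_le_pos; lra.
  + apply Rmult_le_compat_r; lra.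
Qed.

Lemma exp_pow2_mono (y z : R) : 0 <= y <= z ->
  0 < exp (NM / Lm * y ^ 2) <= exp (NM / Lm * z ^ 2).
Proof.
intros Hyz. split; [apply exp_pos |]. apply exp_le.
destruct dimensionless_pos as (p1 & p2 & p3 & p4 & p5 & p6 & p7 & p8).
apply Rmult_le_compat_l; [left; now apply Rdiv_lt_0_compat |]. now apply pow_incr.
Qed.

Lemma D2_mono (y z : R) : 0 <= y <= z -> 0 <= D2 d b y <= D2 d b z.
Proof.
intros Hyz.
destruct dimensionless_pos as (p1 & p2 & p3 & p4 & p5 & p6 & p7 & p8).
assert (h : 0 < Lm ^ 2) by (apply pow_lt; lra).
assert (hc : 0 <= NM * Lt + Lm * Nt) by (apply Rplus_le_le_0_compat; apply Rmult_le_pos; lra).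
assert (hq := exp_pow2_mono y z Hyz).
assert (hy : 0 <= y ^ 2 <= z ^ 2) by (split; [apply pow2_ge_0 | now apply pow_incr]).
assert (hi := Rinv_0_lt_compat _ h). unfold D2.
replace (NM * y ^ 2 / Lm) with (NM / Lm * y ^ 2) by (field; lra).
replace (NM * z ^ 2 / Lm) with (NM / Lm * z ^ 2) by (field; lra).
unfold Rdiv at 1 3 5. split.
- repeat apply Rmult_le_pos; lra.
- apply Rmult_le_compat_r; [easy |]. apply Rmult_le_compat; try lra.
  + repeat apply Rmult_le_pos; lra.
  + apply Rmult_le_compat_r; lra.
Qed.

Lemma exp_mono_mul (y z : R) : 0 <= y < z ->
  1 <= exp (2 * (muM / Lm) * y) < exp (2 * (muM / Lm) * z).
Proof.
intros Hyz.
destruct dimensionless_pos as (p1 & p2 & p3 & p4 & p5 & p6 & p7 & p8).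
assert (0 < muM / Lm) by now apply Rdiv_lt_0_compat.
split.
- apply exp_ge_1. apply Rmult_le_pos; lra.
- apply exp_increasing. apply Rmult_lt_compat_l; lra.
Qed.

Lemma D3_mono (y z : R) : 0 <= y <= z -> 0 <= D3 d b y <= D3 d b z.
Proof.
intros Hyz. unfold D3.
assert (H1 := D1_mono y z Hyz). assert (H2 := D2_mono y z Hyz).
assert (H3 := exp_pow2_mono y z Hyz).
assert (H4 : 0 < exp (2 * (muM / Lm) * y) <= exp (2 * (muM / Lm) * z)).
{ destruct (Req_dec y z) as [-> | N]; [split; [apply exp_pos | apply Rle_refl] |].
  generalize (exp_mono_mul y z ltac:(lra)). lra. }
split; [apply Rplus_le_le_0_compat; apply Rmult_le_pos; lra |].
apply Rplus_le_compat; apply Rmult_le_compat; lra.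
Qed.

(** Strictness comes from the term Lt exp(2 z muM / Lm), as [Lt] and [muM] are positive; [D3]
    contributes a nondecreasing summand. *)
Lemma D4_mono (y z : R) : 0 <= y < z -> 0 < D4 d b y < D4 d b z.
Proof.
intros Hyz. unfold D4.
destruct dimensionless_pos as (p1 & p2 & p3 & p4 & p5 & p6 & p7 & p8).
assert (h : 0 < / Lm ^ 2) by (apply Rinv_0_lt_compat, pow_lt; lra).
assert (H3 := D3_mono y z ltac:(lra)). assert (H4 := exp_mono_mul y z Hyz).
replace (2 * y * (muM / Lm)) with (2 * (muM / Lm) * y) by ring.
replace (2 * z * (muM / Lm)) with (2 * (muM / Lm) * z) by ring.
split.
- apply Rmult_lt_0_compat; [easy |]. apply Rplus_lt_le_0_compat.
  + apply Rmult_lt_0_compat; lra.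
  + apply Rmult_le_pos; lra.
- apply Rmult_lt_compat_l; [easy |]. apply Rplus_lt_le_compat.
  + apply Rmult_lt_compat_l; lra.
  + apply Rmult_le_compat_l; lra.
Qed.

Lemma D4_le (y z : R) : 0 <= y <= z -> D4 d b y <= D4 d b z.
Proof.
intros Hyz. destruct (Req_dec y z) as [-> | N]; [apply Rle_refl |].
left. apply D4_mono. lra.
Qed.

Lemma calE_mono (y z : R) : 0 <= y < z -> 0 < calE d b y < calE d b z.
Proof.
intros Hyz. unfold calE.
destruct dimensionless_pos as (p1 & p2 & p3 & p4 & p5 & p6 & p7 & p8).
assert (H4 := D4_mono y z Hyz).
assert (H3 := exp_pow2_mono y z ltac:(lra)).
assert (H2 : 0 < 2 * LM * D4 d b y)
  by (apply Rmult_lt_0_compat; [apply Rmult_lt_0_compat |]; lra).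
assert (H5 : 2 * LM * D4 d b y < 2 * LM * D4 d b z) by (apply Rmult_lt_compat_l; lra).
split; [apply Rmult_lt_0_compat; lra |].
apply Rlt_le_trans with (2 * LM * D4 d b z * exp (NM / Lm * y ^ 2)).
- apply Rmult_lt_compat_r; lra.
- apply Rmult_le_compat_l; lra.
Qed.

Lemma continuous_calE (x : R) : continuous (calE d b) x.
Proof.
apply (ex_derive_continuous (calE d b)).
unfold calE, D4, D3, D2, D1. auto_derive. easy.
Qed.

(** [D3] vanishes at 0 and the powers of [k0] cancel in 2 LM Lt / Lm^2, so the smallness hypothesis
    says exactly that [calE] starts below 1. *)
Lemma calE_0 : calE d b 0 = 2 * k_hi b * k_lip b * (Tstar d - Tm d) / k_lo b ^ 2.
Proof.
destruct hd as (h1 & h2 & h3 & h4 & h5 & h6). destruct hb as (b1 & _).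
destruct dimensionless_pos as (p1 & _).
unfold calE, D4, D3, D2, D1.
replace (2 * 0 * (muM / Lm)) with 0 by ring.
replace (NM / Lm * 0 ^ 2) with 0 by ring.
rewrite exp_0.
replace (2 * LM * (/ Lm ^ 2 * (Lt * 1 + Lm * (1 * (2 * exp (2 * muM * 0 / Lm) / Lm ^ 2 * 0 * (muM * Lt + Lm * mut)) +
  exp (2 * (muM / Lm) * 0) * (exp (NM * 0 ^ 2 / Lm) / Lm ^ 2 * 0 ^ 2 * (NM * Lt + Lm * Nt))))) * 1)
  with (2 * LM * (/ Lm ^ 2 * Lt)) by ring.
unfold L_m, L_M, L_t. field. lra.
Qed.

Lemma calE_unbounded : exists z, 0 < z /\ 1 < calE d b z.
Proof.
destruct dimensionless_pos as (p1 & p2 & p3 & p4 & p5 & p6 & p7 & p8).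
set (c := 2 * LM * (/ Lm ^ 2 * Lt)). set (r := 2 * (muM / Lm)).
assert (h : 0 < / Lm ^ 2) by (apply Rinv_0_lt_compat, pow_lt; lra).
assert (hc : 0 < c).
{ apply Rmult_lt_0_compat; [lra |]. now apply Rmult_lt_0_compat. }
assert (hr : 0 < r) by (apply Rmult_lt_0_compat; [lra | now apply Rdiv_lt_0_compat]).
(* Chosen so that c exp(r z) >= c (1 + r z) = c + 1 > 1, where c exp(r z) is a lower bound for
   [calE]. *)
exists (/ (c * r)).
assert (hz : 0 < / (c * r)) by now apply Rinv_0_lt_compat, Rmult_lt_0_compat.
set (z := / (c * r)) in *. split; [easy |].
apply Rlt_le_trans with (c * exp (r * z)).
- apply Rlt_le_trans with (c * (1 + r * z)).
  + replace (c * (1 + r * z)) with (c + 1) by (unfold z; field; lra). lra.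
  + apply Rmult_le_compat_l; [lra |]. apply exp_ineq1_le.
(* Only the sign is extracted; z + 1 is an arbitrary larger point. The same device recurs with
   [D1_mono], [D4_mono] and [calE_mono]. *)
- assert (H3 := proj1 (D3_mono z (z + 1) ltac:(lra))).
  assert (He : 1 <= exp (NM / Lm * z ^ 2)).
  { apply exp_ge_1. apply Rmult_le_pos; [| apply pow2_ge_0].
    left. now apply Rdiv_lt_0_compat. }
  unfold calE, D4. replace (2 * z * (muM / Lm)) with (r * z) by (unfold r; ring).
  assert (0 <= Lm * D3 d b z) by (apply Rmult_le_pos; lra).
  assert (0 < exp (r * z)) by apply exp_pos.
  rewrite <- (Rmult_1_r (c * exp (r * z))). apply Rmult_le_compat; try lra.
  + apply Rmult_le_pos; lra.
  + replace (c * exp (r * z)) with (2 * LM * (/ Lm ^ 2 * (Lt * exp (r * z)))) by (unfold c; ring).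
    apply Rmult_le_compat_l; [lra |]. apply Rmult_le_compat_l; lra.
Qed.

Lemma ex_unique_calE_eq_1 : calE d b 0 < 1 ->
  exists l, unique (fun l => 0 < l /\ calE d b l = 1) l.
Proof.
intros H0. destruct calE_unbounded as (z & Hz & H1).
destruct (IVT (fun x => calE d b x - 1) 0 z) as (l & Hl & El); try lra.
- intros x. apply continuity_pt_filterlim.
  apply (continuous_minus (calE d b) (fun _ => 1)); [apply continuous_calE | apply continuous_const].
- exists l. split.
  + split; [| lra]. destruct Hl as [[Hl | <-] _]; lra.
  + intros l' [Hl' El'].
    destruct (Rtotal_order l l') as [H | [H | H]]; [| easy |].
    * generalize (calE_mono l l'); lra.
    * generalize (calE_mono l' l); lra.
Qed.

(** * Lipschitz dependence of [Ef] and [Phi] on the profile *)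

Lemma Ef_dist (f g : R -> R) (z e : R) : cont f -> cont g -> 0 <= z ->
  (forall x, 0 <= x <= z -> Rabs (f x - g x) <= e) ->
  Rabs (Ef d f z - Ef d g z) <= D3 d b z * e.
Proof.
intros Hf Hg Hz He.
destruct dimensionless_pos as (p1 & p2 & p3 & p4 & p5 & p6 & p7 & p8).
assert (He0 : 0 <= e) by (eapply Rle_trans; [apply Rabs_pos | apply (He 0); lra]).
eapply Rle_trans.
(* Since [If] is at least 1, m = 1 is allowed. The factor exp(NM z^2 / Lm) in front of [D1] in [D3]
   is then gained for free, being at least 1. *)
- apply (Rdiv_dist _ _ _ _ 1 (exp (2 * (muM / Lm) * z)) (D1 d b z * e) (D2 d b z * e)).
  + lra.
  + now apply If_ge_1.
  + now apply If_ge_1.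
  + split; [left; apply exp_pos |]. apply exp_le.
    generalize (RInt_mus_Ls_bounds g z Hg Hz). lra.
  + now apply Uf_dist.
  + now apply If_dist.
- rewrite pow1, Rdiv_1_r. unfold D3.
  assert (1 <= exp (NM / Lm * z ^ 2)).
  { apply exp_ge_1. apply Rmult_le_pos; [| apply pow2_ge_0].
    left. now apply Rdiv_lt_0_compat. }
  assert (H1 := proj1 (D1_mono z (z + 1) ltac:(lra))).
  assert (0 <= D1 d b z * e) by now apply Rmult_le_pos.
  rewrite Rmult_plus_distr_r, Rplus_comm, (Rmult_assoc (exp (2 * _ * z))).
  apply Rplus_le_compat_r. rewrite Rmult_assoc.
  apply Rmult_le_compat_r; easy.
Qed.

Lemma Phi_dist (f g : R -> R) (z lam e : R) : cont f -> cont g -> 0 <= z <= lam ->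
  (forall x, 0 <= x <= lam -> Rabs (f x - g x) <= e) ->
  Rabs (Phi d f z - Phi d g z) <= lam * D4 d b lam * e.
Proof.
intros Hf Hg Hz He.
destruct dimensionless_pos as (p1 & p2 & p3 & p4 & p5 & p6 & p7 & p8).
assert (He0 : 0 <= e) by (eapply Rle_trans; [apply Rabs_pos | apply (He 0); lra]).
assert (H4 := proj1 (D4_mono lam (lam + 1) ltac:(lra))).
set (c := D4 d b lam * e).
assert (Hc : 0 <= c) by (apply Rmult_le_pos; lra).
apply Rle_trans with (z * c - 0 * c).
- apply (RInt_diff_le_primitive _ _ (fun _ => c) (fun z => z * c)); try easy.
  + now apply continuous_Ef_Ls.
  + now apply continuous_Ef_Ls.
  + intros; apply continuous_const.
  + intros x. auto_derive; [easy | ring].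
  + intros x Hx. eapply Rle_trans.
    * apply (Rdiv_dist _ _ _ _ Lm (exp (2 * x * (muM / Lm))) (D3 d b x * e) (Lt * e));
        try easy; try apply Ls_bounds.
      { split; [left; apply Ef_pos | now apply Ef_upper]. }
      { apply Ef_dist; try easy. intros t Ht. apply He. lra. }
      eapply Rle_trans; [apply Ls_bounds |]. apply Rmult_le_compat_l; [lra |]. apply He; lra.
    (* The quotient bound is exactly [D4] at x; monotonicity then replaces x by lam, which makes the
       estimate uniform on [0, lam]. *)
    * apply Rle_trans with (D4 d b x * e); [right; unfold D4; field; lra |].
      apply Rmult_le_compat_r; [easy |]. apply D4_le. lra.
- replace (lam * D4 d b lam * e) with (lam * c) by (unfold c; ring).
  assert (z * c <= lam * c) by (apply Rmult_le_compat_r; lra). lra.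
Qed.

(** * The fixed point and its dependence on lam *)

Lemma Phi_0 (f : R -> R) : Phi d f 0 = 0.
Proof. apply (RInt_point (V := R_CompleteNormedModule)). Qed.

Lemma denominator_ge_1 (f : R -> R) (x : R) : cont f -> 0 <= x -> 1 <= 1 + 2 * Bi d * Phi d f x.
Proof.
intros Hf Hx. assert (0 <= 2 * Bi d * Phi d f x); [| lra].
generalize Bi_pos (Phi_ge_0 f x Hf Hx). intros. apply Rmult_le_pos; lra.
Qed.

Lemma continuous_solution_operator (lam : R) (f : R -> R) : 0 <= lam -> cont f ->
  cont (solution_operator d lam f).
Proof.
intros Hl Hf x. unfold solution_operator, Rdiv.
apply (continuous_mult _ (fun _ => / (1 + 2 * Bi d * Phi d f lam))); [| apply continuous_const].
apply (continuous_comp (clamp lam) (fun x => 1 + 2 * Bi d * Phi d f x)); [apply continuous_clamp |].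
apply (continuous_plus (fun _ => 1)); [apply continuous_const |].
apply (continuous_scal_r (2 * Bi d) (Phi d f)).
apply (ex_derive_continuous (Phi d f)). eexists. now apply is_derive_Phi.
Qed.

Lemma solution_operator_bound (lam : R) (f : R -> R) (x : R) : 0 <= lam -> cont f ->
  Rabs (solution_operator d lam f x) <= 1.
Proof.
intros Hl Hf. destruct (clamp_bounds lam x Hl) as [H1 H2].
generalize (denominator_ge_1 f _ Hf H1) (denominator_ge_1 f _ Hf Hl). intros A1 A2.
assert (H3 := Phi_le f _ _ Hf H2). generalize Bi_pos; intros HB.
assert (2 * Bi d * Phi d f (clamp lam x) <= 2 * Bi d * Phi d f lam)
  by (apply Rmult_le_compat_l; lra).
unfold solution_operator. rewrite Rabs_pos_eq by (apply Rdiv_le_0_compat; lra).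
apply Rle_div_l; lra.
Qed.

(* The factor [lam] in the bound on [Phi] cancels against the lower bound
   [2 Bi lam exp (- N_M lam^2 / L_m) / L_M] for the denominator. *)
Lemma solution_operator_contraction (lam e : R) (f g : R -> R) (x : R) :
  0 < lam -> cont f -> cont g ->
  (forall x, 0 <= x <= lam -> Rabs (f x - g x) <= e) ->
  Rabs (solution_operator d lam f x - solution_operator d lam g x) <= calE d b lam * e.
Proof.
intros Hl Hf Hg He.
destruct dimensionless_pos as (p1 & p2 & p3 & p4 & p5 & p6 & p7 & p8).
generalize Bi_pos; intros HB.
assert (He0 : 0 <= e) by (eapply Rle_trans; [apply Rabs_pos | apply (He 0); lra]).
destruct (clamp_bounds lam x) as [H1 H2]; [lra |].
set (c := 2 * Bi d * (lam * D4 d b lam * e)).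
assert (HP : forall z, 0 <= z <= lam ->
  Rabs (1 + 2 * Bi d * Phi d f z - (1 + 2 * Bi d * Phi d g z)) <= c).
{ intros z Hz.
  replace (1 + 2 * Bi d * Phi d f z - (1 + 2 * Bi d * Phi d g z))
    with (2 * Bi d * (Phi d f z - Phi d g z)) by ring.
  rewrite Rabs_mult, (Rabs_pos_eq (2 * Bi d)) by lra.
  apply Rmult_le_compat_l; [lra |]. now apply Phi_dist. }
assert (Hgx := Phi_le g _ _ Hg H2).
generalize (denominator_ge_1 g _ Hg H1) (denominator_ge_1 g lam Hg ltac:(lra))
  (denominator_ge_1 f lam Hf ltac:(lra)). intros A1 A2 A3.
eapply Rle_trans.
(* Numerator and denominator each move by at most c: this is the leading factor 2 of [calE]. *)
- apply (Rdiv_dist_fraction _ _ _ _ c c); try lra.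
  + split; [lra |]. assert (2 * Bi d * Phi d g (clamp lam x) <= 2 * Bi d * Phi d g lam)
      by (apply Rmult_le_compat_l; lra). lra.
  + now apply HP.
  + apply HP. lra.
- apply Rle_div_l; [lra |].
  assert (HPl := Phi_lower f lam Hf ltac:(lra)).
  set (E := exp (NM / Lm * lam ^ 2)) in *.
  assert (HE : 0 < E) by apply exp_pos.
  assert (H4 := proj1 (D4_mono lam (lam + 1) ltac:(lra))).
  rewrite exp_Ropp in HPl. fold E in HPl.
  apply Rle_trans with (calE d b lam * e * (2 * Bi d * (lam * (/ E / LM)))).
  + right. unfold calE, c. fold E. field. lra.
  + apply Rmult_le_compat_l.
    * apply Rmult_le_pos; [| easy]. left. apply (calE_mono lam (lam + 1)). lra.
    * assert (2 * Bi d * (lam * (/ E / LM)) <= 2 * Bi d * Phi d f lam)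
        by (apply Rmult_le_compat_l; lra). lra.
Qed.

Lemma ex_fixed_point (lam : R) : 0 < lam -> calE d b lam < 1 ->
  exists f, cont f /\ forall x, f x = solution_operator d lam f x.
Proof.
intros Hl HE. apply (banach_continuous _ (calE d b lam)).
- split; [| easy]. left. apply (calE_mono lam (lam + 1)). lra.
- intros f. apply continuous_solution_operator. lra.
- intros f Hf x. apply solution_operator_bound; [lra | easy].
- intros f g e Hf Hg He x. now apply solution_operator_contraction.
Qed.

Lemma Phi_lipschitz (Lam : R) (f : R -> R) (x y : R) : cont f ->
  0 <= x <= Lam -> 0 <= y <= Lam ->
  Rabs (Phi d f x - Phi d f y) <= exp (2 * Lam * (muM / Lm)) / Lm * Rabs (x - y).
Proof.
intros Hf.
destruct dimensionless_pos as (p1 & p2 & p3 & p4 & p5 & p6 & p7 & p8).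
apply (lipschitz_of_derive (Phi d f) (fun x => Ef d f x / Ls d f x)).
- intros z. now apply is_derive_Phi.
- intros z Hz. rewrite Rabs_pos_eq.
  + apply Rdiv_le_compat; [| split; [easy | apply Ls_bounds]].
    split; [left; apply Ef_pos |]. eapply Rle_trans; [now apply Ef_upper |].
    apply exp_le, Rmult_le_compat_r; [left; now apply Rdiv_lt_0_compat | lra].
  + left. apply Rdiv_lt_0_compat; [apply Ef_pos | apply Ls_pos].
Qed.

(** The constant is chosen before f: along the family of profiles, f changes together with lam. *)
Lemma Ef_lipschitz (Lam : R) : 0 <= Lam -> exists C, 0 <= C /\
  forall f x y, cont f -> 0 <= x <= Lam -> 0 <= y <= Lam ->
  Rabs (Ef d f x - Ef d f y) <= C * Rabs (x - y).
Proof.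
intros HL.
destruct dimensionless_pos as (p1 & p2 & p3 & p4 & p5 & p6 & p7 & p8).
assert (0 <= Lam * NM) by (apply Rmult_le_pos; lra).
exists (2 * ((muM + Lam * NM) / Lm) * exp (2 * Lam * (muM / Lm))). split.
- apply Rmult_le_pos; [| left; apply exp_pos].
  apply Rmult_le_pos; [lra |]. apply Rdiv_le_0_compat; lra.
- intros f x y Hf.
  apply (lipschitz_of_derive (Ef d f)
    (fun z => 2 * ((mus d f z - z * Ns d f z) / Ls d f z) * Ef d f z)).
  + intros z. now apply is_derive_Ef.
  + intros z Hz. rewrite !Rabs_mult, (Rabs_pos_eq 2), (Rabs_pos_eq (Ef d f z))
      by (try lra; left; apply Ef_pos).
    apply Rmult_le_compat.
    * apply Rmult_le_pos; [lra | apply Rabs_pos].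
    * left; apply Ef_pos.
    * apply Rmult_le_compat_l; [lra |].
      unfold Rdiv. rewrite Rabs_mult, (Rabs_pos_eq (/ Ls d f z))
        by (left; apply Rinv_0_lt_compat, Ls_pos).
      apply (Rdiv_le_compat _ _ (Ls d f z) Lm); [| split; [easy | apply Ls_bounds]].
      split; [apply Rabs_pos |].
      assert (HN := proj1 Ns_bounds f z). assert (Hm := proj1 mus_bounds f z).
      assert (0 <= z * Ns d f z <= Lam * NM).
      { split; [apply Rmult_le_pos; lra | apply Rmult_le_compat; lra]. }
      apply Rabs_le. lra.
    * eapply Rle_trans; [now apply Ef_upper |].
      apply exp_le, Rmult_le_compat_r; [left; now apply Rdiv_lt_0_compat | lra].
Qed.

Lemma solution_operator_lam_lipschitz (Lam lam lam' : R) (f : R -> R) (x : R) : cont f ->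
  0 < lam <= Lam -> 0 < lam' <= Lam ->
  Rabs (solution_operator d lam f x - solution_operator d lam' f x) <=
  4 * Bi d * (exp (2 * Lam * (muM / Lm)) / Lm) * Rabs (lam - lam').
Proof.
intros Hf Hl Hl'. generalize Bi_pos; intros HB.
set (M := exp (2 * Lam * (muM / Lm)) / Lm).
assert (HM : 0 <= M).
{ left. apply Rdiv_lt_0_compat; [apply exp_pos | apply dimensionless_pos]. }
destruct (clamp_bounds lam x) as [H1 H2]; [lra |].
destruct (clamp_bounds lam' x) as [H1' H2']; [lra |].
set (c := 2 * Bi d * (M * Rabs (lam - lam'))).
assert (HP : forall y z, 0 <= y <= Lam -> 0 <= z <= Lam -> Rabs (y - z) <= Rabs (lam - lam') ->
  Rabs (1 + 2 * Bi d * Phi d f y - (1 + 2 * Bi d * Phi d f z)) <= c).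
{ intros y z Hy Hz Hyz.
  replace (1 + 2 * Bi d * Phi d f y - (1 + 2 * Bi d * Phi d f z))
    with (2 * Bi d * (Phi d f y - Phi d f z)) by ring.
  rewrite Rabs_mult, (Rabs_pos_eq (2 * Bi d)) by lra.
  apply Rmult_le_compat_l; [lra |]. eapply Rle_trans; [now apply (Phi_lipschitz Lam) |].
  now apply Rmult_le_compat_l. }
assert (Hgx := Phi_le f _ _ Hf H2').
generalize (denominator_ge_1 f _ Hf H1') (denominator_ge_1 f lam Hf ltac:(lra))
  (denominator_ge_1 f lam' Hf ltac:(lra)). intros A1 A2 A3.
eapply Rle_trans.
- apply (Rdiv_dist_fraction _ _ _ _ c c); try lra.
  + split; [lra |]. assert (2 * Bi d * Phi d f (clamp lam' x) <= 2 * Bi d * Phi d f lam')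
      by (apply Rmult_le_compat_l; lra). lra.
  + apply HP; try lra. apply clamp_lam_dist.
  + apply HP; lra.
- replace (4 * Bi d * M * Rabs (lam - lam')) with (c + c) by (unfold c; ring).
  assert (0 <= c) by (apply Rmult_le_pos; [lra |]; apply Rmult_le_pos; [easy | apply Rabs_pos]).
  apply Rle_div_l; nra.
Qed.

Lemma calE_le (y z : R) : 0 <= y <= z -> 0 <= calE d b y <= calE d b z.
Proof.
intros Hyz. destruct (Req_dec y z) as [-> | N].
- split; [left; apply (calE_mono z (z + 1)); lra | apply Rle_refl].
- generalize (calE_mono y z); lra.
Qed.

(** Writing S for the operator, S_lam f - S_lam' g is split at S_lam g: the first part contracts
    with ratio at most [calE d b Lam], the second is a change of lam at fixed profile. The case lam
    = lam' yields uniqueness. *)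
Lemma fixed_point_lipschitz (Lam lam lam' : R) (f g : R -> R) (x : R) :
  calE d b Lam < 1 -> 0 < lam <= Lam -> 0 < lam' <= Lam -> cont f -> cont g ->
  (forall x, f x = solution_operator d lam f x) ->
  (forall x, g x = solution_operator d lam' g x) ->
  Rabs (f x - g x) <=
  4 * Bi d * (exp (2 * Lam * (muM / Lm)) / Lm) * Rabs (lam - lam') / (1 - calE d b Lam).
Proof.
intros HE Hl Hl' Hf Hg Ef Eg.
assert (Hq := calE_le lam Lam ltac:(lra)).
apply (sup_contraction (fun x => f x - g x) 2); [lra | |].
- intros y. rewrite Ef, Eg. eapply Rle_trans; [apply Rabs_triang |].
  rewrite Rabs_Ropp.
  generalize (solution_operator_bound lam f y ltac:(lra) Hf)
    (solution_operator_bound lam' g y ltac:(lra) Hg). lra.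
- intros e He y.
  assert (He0 : 0 <= e) by (eapply Rle_trans; [apply Rabs_pos | apply (He 0)]).
  replace (f y - g y) with ((solution_operator d lam f y - solution_operator d lam g y) +
    (solution_operator d lam g y - solution_operator d lam' g y))
    by (rewrite (Ef y), (Eg y); ring).
  eapply Rle_trans; [apply Rabs_triang |]. apply Rplus_le_compat.
  + eapply Rle_trans.
    * apply (solution_operator_contraction lam e); [lra | easy | easy |]. intros z _. apply He.
    * apply Rmult_le_compat_r; [easy | apply Hq].
  + now apply solution_operator_lam_lipschitz.
Qed.

Lemma coefficients_ext (f g : R -> R) (x : R) : f x = g x ->
  Ls d f x = Ls d g x /\ Ns d f x = Ns d g x /\ mus d f x = mus d g x.
Proof. intros H. unfold Ls, Ns, mus, temp. now rewrite H. Qed.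

(** Locality lets [f_], whose values off [0, lam] are unknown, be replaced by its continuous
    extension. *)
Lemma Ef_ext (lam : R) (f g : R -> R) : (forall x, 0 <= x <= lam -> f x = g x) ->
  forall z, 0 <= z <= lam -> Ef d f z = Ef d g z.
Proof.
intros H z Hz. rewrite !Ef_exp.
assert (E : forall x, 0 <= x <= lam -> mus d f x / Ls d f x = mus d g x / Ls d g x /\
  x * Ns d f x / Ls d f x = x * Ns d g x / Ls d g x).
{ intros x Hx. destruct (coefficients_ext f g x) as (-> & -> & ->); [now apply H | easy]. }
f_equal; apply f_equal2; apply f_equal; apply RInt_ext; intros x;
  rewrite Rmin_left, Rmax_right by lra; intros Hx; apply E; lra.
Qed.

Lemma Phi_ext (lam : R) (f g : R -> R) : (forall x, 0 <= x <= lam -> f x = g x) ->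
  forall z, 0 <= z <= lam -> Phi d f z = Phi d g z.
Proof.
intros H z Hz. apply RInt_ext.
intros x; rewrite Rmin_left, Rmax_right by lra; intros Hx.
destruct (coefficients_ext f g x) as (-> & _ & _); [apply H; lra |].
rewrite (Ef_ext lam f g H); [easy | lra].
Qed.

Lemma solves_of_fixed_point (lam : R) (f : R -> R) : cont f ->
  (forall x, f x = solution_operator d lam f x) -> solves d lam f.
Proof.
intros Hf E. split.
- intros x _. intros P HP. unfold filtermap, within. generalize (Hf x P HP). apply (filter_imp (F := locally x)). easy.
- intros x Hx. rewrite (E x) at 1. unfold solution_operator. now rewrite clamp_id.
Qed.

Lemma fixed_point_of_solves (lam : R) (f : R -> R) : 0 <= lam -> solves d lam f ->
  cont (fun x => f (clamp lam x)) /\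
  forall x, f (clamp lam x) = solution_operator d lam (fun x => f (clamp lam x)) x.
Proof.
intros Hl [Hc Hs].
assert (E : forall x, 0 <= x <= lam -> f x = f (clamp lam x))
  by (intros x Hx; now rewrite clamp_id).
split.
(* Continuity of f relative to [0, lam] is enough, because [clamp lam] maps the line into
   [0, lam]. *)
- intros x. apply (filterlim_comp _ _ _ (clamp lam) f _
    (within (fun y => 0 <= y <= lam) (locally (clamp lam x)))).
  + intros P HP. unfold within in HP.
    generalize (continuous_clamp lam x _ HP). apply (filter_imp (F := locally x)).
    intros y Hy. apply Hy. now apply clamp_bounds.
  + apply Hc. now apply clamp_bounds.
- intros x. destruct (clamp_bounds lam x Hl) as [H1 H2].
  rewrite Hs by easy. unfold solution_operator.
  rewrite !(Phi_ext lam f _ E); [easy | lra | easy].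
Qed.

Lemma solves_f_ (lam : R) : 0 < lam -> calE d b lam < 1 -> solves d lam (f_ d lam).
Proof.
intros Hl HE. unfold f_. apply epsilon_spec.
destruct (ex_fixed_point lam Hl HE) as (f & Hf & E).
exists f. now apply solves_of_fixed_point.
Qed.

Lemma solves_uniquely_f_ (lam : R) : 0 < lam -> calE d b lam < 1 ->
  solves_uniquely d lam (f_ d lam).
Proof.
intros Hl HE. assert (H1 := solves_f_ lam Hl HE). split; [easy |].
intros g H2 x Hx.
destruct (fixed_point_of_solves lam _ ltac:(lra) H1) as [C1 E1].
destruct (fixed_point_of_solves lam _ ltac:(lra) H2) as [C2 E2].
generalize (fixed_point_lipschitz lam lam lam _ _ x HE ltac:(lra) ltac:(lra) C2 C1 E2 E1).
rewrite Rminus_diag, Rabs_R0, Rmult_0_r, clamp_id by easy.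
unfold Rdiv. rewrite Rmult_0_l. intros H. apply Rminus_diag_uniq, Rabs_eq_0.
apply Rle_antisym; [easy | apply Rabs_pos].
Qed.

(** * The scalar equation V^h(lam) = lam *)

Lemma Vh_clamp (lam : R) : 0 <= lam ->
  Vh d lam = Ste d * Bi d * Ef d (fun x => f_ d lam (clamp lam x)) lam /
    (1 + 2 * Bi d * Phi d (fun x => f_ d lam (clamp lam x)) lam).
Proof.
intros Hl. unfold Vh.
assert (E : forall x, 0 <= x <= lam -> f_ d lam x = f_ d lam (clamp lam x))
  by (intros x Hx; now rewrite clamp_id).
rewrite (Ef_ext lam _ _ E), (Phi_ext lam _ _ E); try easy; lra.
Qed.

Lemma Vh_lipschitz (Lam : R) : 0 < Lam -> calE d b Lam < 1 ->
  exists C, forall lam lam', 0 < lam <= Lam -> 0 < lam' <= Lam ->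
  Rabs (Vh d lam - Vh d lam') <= C * Rabs (lam - lam').
Proof.
intros HL HE.
destruct dimensionless_pos as (p1 & p2 & p3 & p4 & p5 & p6 & p7 & p8).
assert (HB := Bi_pos). assert (HS := Ste_pos).
assert (HSB : 0 < Ste d * Bi d) by now apply Rmult_lt_0_compat.
destruct (Ef_lipschitz Lam) as (CE & HCE & HCE'); [lra |].
set (M := exp (2 * Lam * (muM / Lm)) / Lm).
(* Lipschitz constants in lam of the profile ([Cf]), the denominator ([CP]) and the numerator
   ([CN]). The last two add the effect of the profile to that of the moving endpoint. *)
set (Cf := 4 * Bi d * M / (1 - calE d b Lam)).
set (CP := 2 * Bi d * (Lam * D4 d b Lam * Cf + M)).
set (CN := Ste d * Bi d * (D3 d b Lam * Cf + CE)).
exists (Ste d * Bi d * exp (2 * Lam * (muM / Lm)) * CP + CN).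
intros lam lam' Hl Hl'. rewrite !Vh_clamp by lra.
destruct (fixed_point_of_solves lam (f_ d lam)) as [C1 E1]; [lra | |].
{ apply solves_f_; [lra |]. generalize (calE_le lam Lam); lra. }
destruct (fixed_point_of_solves lam' (f_ d lam')) as [C2 E2]; [lra | |].
{ apply solves_f_; [lra |]. generalize (calE_le lam' Lam); lra. }
set (f := fun x => f_ d lam (clamp lam x)) in *.
set (g := fun x => f_ d lam' (clamp lam' x)) in *.
assert (He : forall x, Rabs (f x - g x) <= Cf * Rabs (lam - lam')).
{ intros x. replace (Cf * Rabs (lam - lam'))
    with (4 * Bi d * M * Rabs (lam - lam') / (1 - calE d b Lam)) by (unfold Cf, Rdiv; ring).
  now apply fixed_point_lipschitz. }
set (D := Rabs (lam - lam')) in *.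
assert (He0 : 0 <= Cf * D) by (eapply Rle_trans; [apply Rabs_pos | apply (He 0)]).
replace ((Ste d * Bi d * exp (2 * Lam * (muM / Lm)) * CP + CN) * D)
  with ((Ste d * Bi d * exp (2 * Lam * (muM / Lm)) * (CP * D) + 1 * (CN * D)) / 1 ^ 2) by field.
apply Rdiv_dist; try lra.
- apply denominator_ge_1; [easy | lra].
- apply denominator_ge_1; [easy | lra].
- split; [apply Rmult_le_pos; [lra | left; apply Ef_pos] |].
  apply Rmult_le_compat_l; [lra |].
  eapply Rle_trans; [apply Ef_upper; [easy | lra] |].
  apply exp_le, Rmult_le_compat_r; [left; now apply Rdiv_lt_0_compat | lra].
- rewrite <- Rmult_minus_distr_l, Rabs_mult, (Rabs_pos_eq (Ste d * Bi d)) by lra.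
  unfold CN. rewrite (Rmult_assoc (Ste d * Bi d)). apply Rmult_le_compat_l; [lra |].
  replace (Ef d f lam - Ef d g lam') with ((Ef d f lam - Ef d g lam) + (Ef d g lam - Ef d g lam')) by ring.
  eapply Rle_trans; [apply Rabs_triang |].
  rewrite Rmult_plus_distr_r. apply Rplus_le_compat.
  + eapply Rle_trans; [apply (Ef_dist f g lam (Cf * D)); try easy; lra |].
    rewrite Rmult_assoc. apply Rmult_le_compat_r; [easy |]. apply D3_mono; lra.
  + apply HCE'; try easy; lra.
- replace (1 + 2 * Bi d * Phi d f lam - (1 + 2 * Bi d * Phi d g lam'))
    with (2 * Bi d * ((Phi d f lam - Phi d g lam) + (Phi d g lam - Phi d g lam'))) by ring.
  rewrite Rabs_mult, (Rabs_pos_eq (2 * Bi d)) by lra.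
  unfold CP. rewrite (Rmult_assoc (2 * Bi d)). apply Rmult_le_compat_l; [lra |].
  eapply Rle_trans; [apply Rabs_triang |].
  rewrite Rmult_plus_distr_r. apply Rplus_le_compat.
  + rewrite Rmult_assoc. apply Phi_dist; try easy; lra.
  + apply Phi_lipschitz; try easy; lra.
Qed.

(** [V2] results from the sharp bounds on [Ef] and [Phi] after dropping the summand 1 of the
    denominator; this makes the inequality strict and cancels [Bi]. *)
Lemma Vh_lt_V2 (lam : R) : 0 < lam -> calE d b lam < 1 -> Vh d lam < V2 d b lam.
Proof.
intros Hl HE.
destruct dimensionless_pos as (p1 & p2 & p3 & p4 & p5 & p6 & p7 & p8).
assert (HB := Bi_pos). assert (HS := Ste_pos).
rewrite Vh_clamp by lra.
destruct (fixed_point_of_solves lam (f_ d lam)) as [Hf _]; [lra | now apply solves_f_ |].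
set (f := fun x => f_ d lam (clamp lam x)) in *.
unfold V2. rewrite <- sqrt_div_alt by easy.
assert (Hr : 0 < sqrt (NM / Lm)) by (apply sqrt_lt_R0; now apply Rdiv_lt_0_compat).
assert (HPI : 0 < sqrt PI) by apply sqrt_lt_R0, PI_RGT_0.
assert (Herf := erf_pos _ (Rmult_lt_0_compat _ _ Hr Hl)).
assert (HP := Phi_lower_erf f lam Hf ltac:(lra)).
assert (HU := Ef_upper_sharp f lam Hf ltac:(lra)).
assert (H0 := Ef_pos f lam).
set (r := sqrt (NM / Lm)) in *. set (w := erf (r * lam)) in *.
set (u := exp (2 * lam * muM / Lm - lam ^ 2 * Nm / LM)) in *.
set (p := sqrt PI / 2 * w / (r * LM)) in *.
assert (Hp : 0 < p).
{ apply Rdiv_lt_0_compat; [| now apply Rmult_lt_0_compat].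
  apply Rmult_lt_0_compat; [lra | easy]. }
replace (Ste d / sqrt PI * r * LM * (u / w)) with (Ste d * Bi d * u / (2 * Bi d * p))
  by (unfold p; field; lra).
assert (HBp : 0 < 2 * Bi d * p) by (apply Rmult_lt_0_compat; lra).
assert (HSB : 0 < Ste d * Bi d) by now apply Rmult_lt_0_compat.
apply Rle_lt_trans with (Ste d * Bi d * u / (1 + 2 * Bi d * p)).
- apply Rdiv_le_compat.
  + split; [apply Rmult_le_pos; lra | apply Rmult_le_compat_l; lra].
  + split; [lra |]. apply Rplus_le_compat_l, Rmult_le_compat_l; lra.
- apply Rmult_lt_compat_l; [apply Rmult_lt_0_compat; lra |].
  apply Rinv_lt_contravar; [apply Rmult_lt_0_compat |]; lra.
Qed.

(** [Ef] is bounded below and [Phi] above uniformly in the profile. This gives the sign near the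
    left end, where no estimate is available at lam = 0 itself. *)
Lemma Vh_lower (Lam : R) : 0 < Lam -> calE d b Lam < 1 ->
  exists c, 0 < c /\ forall lam, 0 < lam <= Lam -> c <= Vh d lam.
Proof.
intros HL HE.
destruct dimensionless_pos as (p1 & p2 & p3 & p4 & p5 & p6 & p7 & p8).
assert (HB := Bi_pos). assert (HS := Ste_pos).
assert (HSB : 0 < Ste d * Bi d) by now apply Rmult_lt_0_compat.
set (M := exp (2 * Lam * (muM / Lm)) / Lm).
assert (HM : 0 < M) by (apply Rdiv_lt_0_compat; [apply exp_pos | easy]).
assert (HBM : 0 < 2 * Bi d * (M * Lam))
  by (apply Rmult_lt_0_compat; [lra | now apply Rmult_lt_0_compat]).
assert (Hn : 0 < Ste d * Bi d * exp (- (NM / Lm * Lam ^ 2)))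
  by (apply Rmult_lt_0_compat; [easy | apply exp_pos]).
exists (Ste d * Bi d * exp (- (NM / Lm * Lam ^ 2)) / (1 + 2 * Bi d * (M * Lam))). split.
- apply Rdiv_lt_0_compat; lra.
- intros lam Hl. rewrite Vh_clamp by lra.
  destruct (fixed_point_of_solves lam (f_ d lam)) as [Hf _]; [lra | |].
  { apply solves_f_; [lra |]. generalize (calE_le lam Lam); lra. }
  set (f := fun x => f_ d lam (clamp lam x)) in *.
  apply Rdiv_le_compat.
  + split; [lra |]. apply Rmult_le_compat_l; [lra |].
    eapply Rle_trans; [| apply Ef_lower; [easy | lra]].
    apply exp_le, Ropp_le_contravar, Rmult_le_compat_l; [left; now apply Rdiv_lt_0_compat |].
    apply pow_incr; lra.
  + assert (H1 := denominator_ge_1 f lam Hf ltac:(lra)). split; [lra |].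
    apply Rplus_le_compat_l, Rmult_le_compat_l; [lra |].
    assert (H := Phi_lipschitz Lam f lam 0 Hf ltac:(lra) ltac:(lra)).
    rewrite Phi_0, !Rminus_0_r, (Rabs_pos_eq lam) in H by lra.
    fold M in H. eapply Rle_trans; [apply Rle_abs |]. eapply Rle_trans; [apply H |].
    apply Rmult_le_compat_l; lra.
Qed.

Lemma ex_Vh_fixed_point (lambda2 : R) : 0 < lambda2 -> calE d b lambda2 < 1 ->
  V2 d b lambda2 = lambda2 -> exists lam, 0 < lam < lambda2 /\ Vh d lam = lam.
Proof.
intros HL HE H2.
assert (HV2 := Vh_lt_V2 lambda2 HL HE). rewrite H2 in HV2.
destruct (Vh_lower lambda2 HL HE) as (c & Hc & Hlow).
destruct (Vh_lipschitz lambda2 HL HE) as (C & HC).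
(* Left end of the search interval: a < c <= V^h(a). *)
set (a := Rmin c lambda2 / 2).
assert (Ha : 0 < a /\ a < c /\ a < lambda2).
{ unfold a, Rmin. destruct (Rle_dec c lambda2); lra. }
(* Retraction of the line onto [a, lambda2]: [IVT] asks for continuity everywhere, while [Vh] is
   controlled on (0, lambda2] only. *)
set (k := fun x => a + clamp (lambda2 - a) (x - a)).
assert (Hk : forall x, a <= k x <= lambda2).
{ intros x. unfold k. generalize (clamp_bounds (lambda2 - a) (x - a)). lra. }
assert (Kid : forall x, a <= x <= lambda2 -> k x = x).
{ intros x Hx. unfold k. rewrite clamp_id; lra. }
destruct (IVT (fun x => x - Vh d (k x)) a lambda2) as (z & Hz & Ez).
- intros x. apply continuity_pt_filterlim.
  apply (continuous_minus (fun x => x) (fun x => Vh d (k x))); [apply continuous_id |].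
  apply (lipschitz_continuous _ (Rmax C 0)). intros u v.
  assert (Hu := Hk u). assert (Hv := Hk v).
  assert (Huv : Rabs (k u - k v) <= Rabs (u - v)).
  { unfold k. generalize (clamp_dist (lambda2 - a) (u - a) (v - a)).
    now replace (u - a - (v - a)) with (u - v) by ring;
      replace (a + clamp (lambda2 - a) (u - a) - (a + clamp (lambda2 - a) (v - a)))
      with (clamp (lambda2 - a) (u - a) - clamp (lambda2 - a) (v - a)) by ring. }
  eapply Rle_trans; [apply HC; lra |]. assert (Hp := Rabs_pos (k u - k v)).
  apply Rle_trans with (Rmax C 0 * Rabs (k u - k v)).
  + apply Rmult_le_compat_r; [easy | apply Rmax_l].
  + apply Rmult_le_compat_l; [apply Rmax_r | lra].
- lra.
- rewrite Kid by lra. generalize (Hlow a); lra.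
- rewrite Kid by lra. lra.
- exists z. rewrite Kid in Ez by easy.
  split; [| lra]. split; [lra |].
  destruct (Req_dec z lambda2) as [-> | N]; lra.
Qed.

(** * Back to the Stefan problem *)

Lemma is_derive_fixed_point (lam x : R) (f : R -> R) : cont f ->
  (forall x, f x = solution_operator d lam f x) -> 0 < x < lam ->
  is_derive f x (2 * Bi d / (1 + 2 * Bi d * Phi d f lam) * (Ef d f x / Ls d f x)).
Proof.
intros Hf E Hx.
set (A := 1 + 2 * Bi d * Phi d f lam).
apply (is_derive_ext_loc (fun y => / A * (1 + 2 * Bi d * Phi d f y))).
- assert (H : locally x (fun y => 0 < y < lam)).
  { apply (locally_interval _ x 0 lam); simpl; tauto. }
  revert H. apply filter_imp. intros y Hy. rewrite (E y). unfold solution_operator.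
  rewrite clamp_id by lra. apply Rmult_comm.
- evar_last.
  + apply (is_derive_scal _ _ (/ A)).
    apply (is_derive_plus (fun _ => 1)); [apply is_derive_const |].
    apply (is_derive_scal _ _ (2 * Bi d)). now apply is_derive_Phi.
  + unfold scal, plus, zero; simpl; unfold mult; simpl. unfold Rdiv. ring.
Qed.

Lemma continuous_similarity (f : R -> R) (p : R * R) : cont f -> 0 < snd p -> 0 < alpha0 d ->
  continuous (fun p : R * R => temp d f (fst p / (2 * sqrt (alpha0 d * snd p)))) p.
Proof.
destruct p as [x t]. simpl. intros Hf Ht Ha. assert (Hs := sqrt_mul_pos _ _ Ha Ht).
apply (continuous_comp (fun p : R * R => fst p / (2 * sqrt (alpha0 d * snd p))) (temp d f)).
- apply (continuous_mult fst (fun p : R * R => / (2 * sqrt (alpha0 d * snd p)))).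
  + apply continuous_fst.
  + apply (continuous_comp snd (fun t => / (2 * sqrt (alpha0 d * t)))); [apply continuous_snd |].
    apply (ex_derive_continuous (fun t => / (2 * sqrt (alpha0 d * t)))). simpl. auto_derive.
    repeat split; [now apply Rmult_lt_0_compat | lra].
- apply (continuous_plus (fun y => (Tm d - Tstar d) * f y)); [| apply continuous_const].
  apply (continuous_scal_r (Tm d - Tstar d) f), Hf.
Qed.

Lemma heat_equation_similarity (lam x t : R) (f : R -> R) : cont f ->
  (forall x, f x = solution_operator d lam f x) ->
  0 < t -> 0 < x < 2 * lam * sqrt (alpha0 d * t) ->
  heat_equation d (fun x t => temp d f (x / (2 * sqrt (alpha0 d * t)))) x t.
Proof.
intros Hf E Ht Hx.
destruct hd as (h1 & h2 & h3 & h4 & h5 & h6).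
assert (h34 : 0 < rho0 d * c0 d) by now apply Rmult_lt_0_compat.
assert (Ha : 0 < alpha0 d) by now apply Rdiv_lt_0_compat.
assert (Hs := sqrt_mul_pos _ _ Ha Ht).
set (r := 2 * sqrt (alpha0 d * t)).
assert (Hr : 0 < r) by (unfold r; lra).
assert (Hxi : forall y, 0 < y < 2 * lam * sqrt (alpha0 d * t) -> 0 < y / r < lam).
{ intros y Hy. split; [apply Rdiv_lt_0_compat; lra |].
  apply Rlt_div_l; [easy |]. unfold r. lra. }
set (A := 1 + 2 * Bi d * Phi d f lam).
set (f' := fun z => 2 * Bi d / A * (Ef d f z / Ls d f z)).
assert (Df : forall z, 0 < z < lam -> is_derive (temp d f) z ((Tm d - Tstar d) * f' z)).
{ intros z Hz. evar_last.
  - apply (is_derive_plus (fun y => (Tm d - Tstar d) * f y)); [| apply is_derive_const].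
    apply (is_derive_scal _ _ (Tm d - Tstar d)). now apply (is_derive_fixed_point lam).
  - apply Rplus_0_r. }
assert (Dx : forall y, 0 < y < 2 * lam * sqrt (alpha0 d * t) ->
  is_derive (fun y => temp d f (y / r)) y ((Tm d - Tstar d) * f' (y / r) / r)).
{ intros y Hy. evar_last.
  - apply (is_derive_comp (temp d f) (fun y => y / r)); [now apply Df, Hxi |].
    auto_derive; [lra | reflexivity].
  - unfold scal; simpl; unfold mult; simpl. field. lra. }
assert (Dt : is_derive (fun tau => temp d f (x / (2 * sqrt (alpha0 d * tau)))) t
  (- (x / r) / (2 * t) * ((Tm d - Tstar d) * f' (x / r)))).
{ apply (is_derive_comp (temp d f) (fun tau => x / (2 * sqrt (alpha0 d * tau)))).
  - now apply Df, Hxi.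
  - now apply is_derive_similarity_variable. }
set (K := k0 d * (Tm d - Tstar d) * (2 * Bi d / A) / r).
assert (Dq : is_derive (fun y => kf d (temp d f (y / r)) *
    Derive (fun z => temp d f (z / r)) y) x
  (K * (2 * ((mus d f (x / r) - x / r * Ns d f (x / r)) / Ls d f (x / r)) * Ef d f (x / r)) / r)).
(* The factor L in k(T) = k0 L cancels the 1 / L in f', so the flux is K times [Ef] and no
   derivative of [kf] is taken. *)
{ apply (is_derive_ext_loc (fun y => K * Ef d f (y / r))).
  - assert (H : locally x (fun y => 0 < y < 2 * lam * sqrt (alpha0 d * t))).
    { apply (locally_interval _ x 0 (2 * lam * sqrt (alpha0 d * t))); simpl; tauto. }
    revert H. apply filter_imp. intros y Hy. cbv beta.
    replace (Derive (fun z => temp d f (z / r)) y) with ((Tm d - Tstar d) * f' (y / r) / r)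
      by (symmetry; apply (is_derive_unique _ _ _ (Dx y Hy))).
    replace (kf d (temp d f (y / r))) with (k0 d * Ls d f (y / r)) by (unfold Ls; field; lra).
    assert (HL := Ls_pos f (y / r)).
    assert (HA : 1 <= A).
    { apply denominator_ge_1; [easy |]. specialize (Hxi y Hy). lra. }
    unfold K, f'. simpl. field. lra.
  - evar_last.
    + apply (is_derive_scal (fun y => Ef d f (y / r)) x K).
      apply (is_derive_comp (Ef d f) (fun y => y / r)); [now apply is_derive_Ef |].
      auto_derive; [lra | reflexivity].
    + unfold scal; simpl; unfold mult; simpl. field. split; [lra |].
      generalize (Ls_pos f (x / r)); lra. }
unfold heat_equation. cbv zeta beta. fold r.
split; [eexists; exact Dt |]. split; [eexists; exact (Dx x Hx) |].
split; [eexists; exact Dq |].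
apply is_derive_unique in Dt. apply is_derive_unique in Dq.
assert (Dx' := is_derive_unique _ _ _ (Dx x Hx)).
simpl in Dt, Dq, Dx'. rewrite Dt, Dq, Dx'.
unfold vconv. fold r.
assert (Hw := sqrt_rho0c0k0_pos).
set (w := sqrt (rho0 d * c0 d * k0 d)) in *.
replace (muf d (temp d f (x / r))) with (w * mus d f (x / r)) by (unfold mus; fold w; field; lra).
replace (rhof d (temp d f (x / r)) * cf d (temp d f (x / r)))
  with (rho0 d * c0 d * Ns d f (x / r)) by (unfold Ns; field; lra).
assert (HL := Ls_pos f (x / r)).
assert (HA : 1 <= A) by (apply denominator_ge_1; [easy |]; specialize (Hxi x Hx); lra).
assert (Hst : 0 < sqrt t) by now apply sqrt_lt_R0.
assert (Hrt : r * r = 4 * (k0 d / (rho0 d * c0 d)) * t).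
{ unfold r. replace (2 * sqrt (alpha0 d * t) * (2 * sqrt (alpha0 d * t)))
    with (4 * (sqrt (alpha0 d * t) * sqrt (alpha0 d * t))) by ring.
  rewrite sqrt_sqrt; [unfold alpha0; ring |]. left; now apply Rmult_lt_0_compat. }
assert (Hwr : w / sqrt t / r = rho0 d * c0 d / (2 * t)).
{ unfold r. rewrite sqrt_mult by lra.
  assert (Ew : w = rho0 d * c0 d * sqrt (alpha0 d)).
  { unfold w. replace (rho0 d * c0 d * k0 d)
      with ((rho0 d * c0 d) * (rho0 d * c0 d) * alpha0 d) by (unfold alpha0; field; lra).
    rewrite sqrt_mult, sqrt_square; try lra. apply Rmult_le_pos; lra. }
  assert (Hsa : 0 < sqrt (alpha0 d)) by now apply sqrt_lt_R0.
  assert (Et : t = sqrt t * sqrt t) by (symmetry; apply sqrt_sqrt; lra).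
  (* The third occurrence is the t outside the square roots. *)
  rewrite Ew. rewrite Et at 3. field. lra. }
set (xi := x / r) in *.
(* By [Hrt] and [Hwr] the mu part of the flux derivative is exactly the convective term; after
   cancellation only the - xi N part is left. *)
transitivity (rho0 d * c0 d * (Tm d - Tstar d) * f' xi / (2 * t) * (- xi * Ns d f xi)).
- field. lra.
- transitivity (4 * k0 d / (r * r) * ((Tm d - Tstar d) * f' xi / 2 *
    (mus d f xi - xi * Ns d f xi)) -
    w / sqrt t / r * mus d f xi * ((Tm d - Tstar d) * f' xi)).
  + rewrite Hwr, Hrt. field. lra.
  + unfold K, f'. field. lra.
Qed.

(** Serves both ends of the domain, P selecting the side from which x is approached. *)
Lemma flux_at_boundary (lam t x : R) (f : R -> R) (P : R -> Prop) : cont f ->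
  (forall x, f x = solution_operator d lam f x) -> 0 < lam -> 0 < t ->
  0 <= x / (2 * sqrt (alpha0 d * t)) <= lam ->
  (forall y, P y -> y <> x) ->
  (forall y, P y -> Rabs (y - x) < lam * (2 * sqrt (alpha0 d * t)) ->
     0 <= y / (2 * sqrt (alpha0 d * t)) <= lam) ->
  exists q, filterlim (fun y => (temp d f (y / (2 * sqrt (alpha0 d * t))) -
      temp d f (x / (2 * sqrt (alpha0 d * t)))) / (y - x)) (within P (locally x)) (locally q) /\
    kf d (temp d f (x / (2 * sqrt (alpha0 d * t)))) * q =
    k0 d * (Tm d - Tstar d) * Bi d / (1 + 2 * Bi d * Phi d f lam) *
    Ef d f (x / (2 * sqrt (alpha0 d * t))) / sqrt (alpha0 d * t).
Proof.
intros Hf E Hl Ht Hx HP HPr.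
destruct hd as (h1 & h2 & h3 & h4 & h5 & h6).
assert (h34 : 0 < rho0 d * c0 d) by now apply Rmult_lt_0_compat.
assert (Ha : 0 < alpha0 d) by now apply Rdiv_lt_0_compat.
assert (Hs := sqrt_mul_pos _ _ Ha Ht).
set (s := sqrt (alpha0 d * t)) in *.
set (A := 1 + 2 * Bi d * Phi d f lam).
assert (HA : 1 <= A) by (apply denominator_ge_1; [easy | lra]).
exists ((Tm d - Tstar d) * / A * (2 * Bi d * (Ef d f (x / (2 * s)) / Ls d f (x / (2 * s)) / (2 * s)))).
assert (Ef' : forall y, 0 <= y / (2 * s) <= lam -> temp d f (y / (2 * s)) =
  (Tm d - Tstar d) * / A * (1 + 2 * Bi d * Phi d f (y / (2 * s))) + Tstar d).
{ intros y Hy. unfold temp. rewrite (E (y / (2 * s))). unfold solution_operator.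
  rewrite clamp_id by easy. fold A. unfold Rdiv. ring. }
split.
- apply (one_sided_derive P (fun y => temp d f (y / (2 * s)))
    (fun y => (Tm d - Tstar d) * / A * (1 + 2 * Bi d * Phi d f (y / (2 * s))) + Tstar d)
    x _ (lam * (2 * s))).
  + apply Rmult_lt_0_compat; lra.
  + evar_last.
    * apply (is_derive_plus (fun y => (Tm d - Tstar d) * / A * (1 + 2 * Bi d * Phi d f (y / (2 * s)))));
        [| apply is_derive_const].
      apply (is_derive_scal _ _ ((Tm d - Tstar d) * / A)).
      apply (is_derive_plus (fun _ => 1)); [apply is_derive_const |].
      apply (is_derive_scal _ _ (2 * Bi d)).
      apply (is_derive_comp (Phi d f) (fun y => y / (2 * s))); [now apply is_derive_Phi |].
      auto_derive; [lra | reflexivity].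
    * unfold scal, plus, zero; simpl; unfold mult; simpl. field.
      generalize (Ls_pos f (x / (2 * s))). lra.
  + now apply Ef'.
  + easy.
  + intros y Py Hy. now apply Ef', HPr.
- replace (kf d (temp d f (x / (2 * s)))) with (k0 d * Ls d f (x / (2 * s)))
    by (unfold Ls; field; lra).
  field. generalize (Ls_pos f (x / (2 * s))). lra.
Qed.

Lemma stefan_solution_similarity (lam : R) (f : R -> R) : 0 < lam -> cont f ->
  (forall x, f x = solution_operator d lam f x) ->
  Ste d * Bi d * Ef d f lam / (1 + 2 * Bi d * Phi d f lam) = lam ->
  stefan_solution d (fun x t => temp d f (x / (2 * sqrt (alpha0 d * t))))
    (fun t => 2 * lam * sqrt (alpha0 d * t)).
Proof.
intros Hl Hf E HV.
destruct hd as (h1 & h2 & h3 & h4 & h5 & h6).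
assert (h34 : 0 < rho0 d * c0 d) by now apply Rmult_lt_0_compat.
assert (Ha : 0 < alpha0 d) by now apply Rdiv_lt_0_compat.
assert (Hsa : 0 < sqrt (alpha0 d)) by now apply sqrt_lt_R0.
set (A := 1 + 2 * Bi d * Phi d f lam) in *.
assert (HA : 1 <= A) by (apply denominator_ge_1; [easy | lra]).
assert (Hxi : forall t, 0 < t -> 2 * lam * sqrt (alpha0 d * t) / (2 * sqrt (alpha0 d * t)) = lam).
{ intros t Ht. assert (Hs := sqrt_mul_pos _ _ Ha Ht). field. lra. }
refine (conj _ (conj _ (conj _ (conj _ (conj _ (conj _ _)))))).
- intros t _ P HP. unfold filtermap, within.
  assert (C : continuous (fun t => 2 * lam * sqrt (alpha0 d * t)) t).
  { apply (continuous_scal_r (2 * lam) (fun t => sqrt (alpha0 d * t))).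
    apply continuous_sqrt_comp.
    apply (ex_derive_continuous (fun t => alpha0 d * t)). now auto_derive. }
  generalize (C P HP). apply (filter_imp (F := locally t)). easy.
- intros p [Hp _] P HP. unfold filtermap, within.
  generalize (continuous_similarity f p Hf Hp Ha P HP). apply (filter_imp (F := locally p)). easy.
- intros x t Ht Hx. now apply (heat_equation_similarity lam).
- intros t Ht. assert (Hs := sqrt_mul_pos _ _ Ha Ht).
  destruct (flux_at_boundary lam t 0 f (fun y => 0 < y) Hf E Hl Ht) as (q & Hq & Eq).
  + unfold Rdiv. rewrite Rmult_0_l. lra.
  + intros; lra.
  + intros y Hy. rewrite Rminus_0_r, Rabs_pos_eq by lra. intros H.
    split; [apply Rdiv_le_0_compat; lra |]. apply Rle_div_l; lra.
  + exists q. split; [exact Hq |]. rewrite Eq.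
    replace (0 / (2 * sqrt (alpha0 d * t))) with 0 by (unfold Rdiv; ring).
    replace (temp d f 0 - Tstar d) with ((Tm d - Tstar d) / A).
    2:{ unfold temp. rewrite (E 0). unfold solution_operator.
        rewrite clamp_id, Phi_0 by lra. fold A. field. lra. }
    (* With E(0) = 1 and f(0) = 1 / A, the convective condition is the definition of [Bi]. *)
    rewrite Ef_exp, !RInt_point. unfold zero; simpl. rewrite Rmult_0_r, Rminus_0_r, exp_0.
    fold A. unfold Bi. rewrite sqrt_mult by lra.
    assert (0 < sqrt t) by now apply sqrt_lt_R0. field. lra.
- intros t Ht. rewrite Hxi by easy. unfold temp. rewrite (E lam). unfold solution_operator.
  rewrite clamp_id by lra. fold A. field. lra.
- intros t Ht. assert (Hs := sqrt_mul_pos _ _ Ha Ht).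
  assert (Dv : is_derive (fun t => 2 * lam * sqrt (alpha0 d * t)) t
    (lam * alpha0 d / sqrt (alpha0 d * t))).
  { evar_last.
    - apply (is_derive_scal (fun t => sqrt (alpha0 d * t)) t (2 * lam)).
      apply (is_derive_comp sqrt (fun t => alpha0 d * t)).
      + apply is_derive_Reals, derivable_pt_lim_sqrt. now apply Rmult_lt_0_compat.
      + auto_derive; [easy | reflexivity].
    - unfold scal; simpl; unfold mult; simpl. field. lra. }
  split; [eexists; exact Dv |].
  destruct (flux_at_boundary lam t (2 * lam * sqrt (alpha0 d * t)) f
    (fun y => y < 2 * lam * sqrt (alpha0 d * t)) Hf E Hl Ht) as (q & Hq & Eq).
  + rewrite Hxi by easy. lra.
  + intros; lra.
  + intros y Hy. rewrite Rabs_left by lra. intros H1.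
    split; [apply Rdiv_le_0_compat; lra |]. apply Rle_div_l; lra.
  + exists q. split; [exact Hq |]. rewrite Eq, Hxi by easy.
    apply is_derive_unique in Dv. simpl in Dv. rewrite Dv.
    fold A. set (w := sqrt (alpha0 d * t)) in *.
    (* The Stefan condition is V^h(lam) = lam, used here to rewrite the speed of the free
       boundary. *)
    replace (lam * alpha0 d / w) with
      (Ste d * Bi d * Ef d f lam / A * (k0 d / (rho0 d * c0 d)) / w) by now rewrite HV.
    unfold Ste. field. lra.
- rewrite Rmult_0_r, sqrt_0. ring.
Qed.

End Stefan.

Theorem theorem4p3 (d : data) (b : bounds) (lambda2 : R)
    (hd : positive_data d) (hb : positive_bounds b)
    (hK : hyp_K d b) (hR : hyp_R d b) (hV : hyp_V d b)
    (hsmall : 2 * k_hi b * k_lip b * (Tstar d - Tm d) / k_lo b ^ 2 < 1)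
    (hlambda2 : 0 < lambda2) (hV2 : V2 d b lambda2 = lambda2)
    (hE : calE d b lambda2 < 1) :
  exists lambda_bar : R,
    unique (fun l => 0 < l /\ calE d b l = 1) lambda_bar /\
    exists (lam : R) (T : R -> R -> R) (s : R -> R),
      0 < lam < lambda2 /\
      lam < lambda_bar /\
      solves_uniquely d lam (f_ d lam) /\
      Vh d lam = lam /\
      stefan_solution d T s /\
      (forall t, 0 < t -> s t = 2 * lam * sqrt (alpha0 d * t)) /\
      (forall x t, 0 < t ->
         let xi := x / (2 * sqrt (alpha0 d * t)) in
         0 <= xi <= lam -> T x t = (Tm d - Tstar d) * f_ d lam xi + Tstar d).
Proof.
assert (h0 : calE d b 0 < 1) by now rewrite calE_0.
destruct (ex_unique_calE_eq_1 d b hd hb h0) as (lbar & Hbar).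
exists lbar. split; [easy |].
destruct Hbar as [[Hb1 Hb2] _].
destruct (ex_Vh_fixed_point d b hd hb hK hR hV lambda2 hlambda2 hE hV2) as (lam & Hl & HV).
assert (HE : calE d b lam < 1).
{ generalize (calE_le d b hd hb lam lambda2); lra. }
destruct (fixed_point_of_solves d lam (f_ d lam)) as [Hf E]; [lra | |].
{ apply (solves_f_ d b); easy. }
exists lam, (fun x t => temp d (fun x => f_ d lam (clamp lam x)) (x / (2 * sqrt (alpha0 d * t)))),
  (fun t => 2 * lam * sqrt (alpha0 d * t)).
split; [easy |]. split.
(* Otherwise monotonicity would give 1 = [calE d b lbar] <= [calE d b lam] < 1. *)
{ destruct (Rlt_or_le lam lbar) as [H | H]; [easy |].
  generalize (calE_le d b hd hb lbar lam); lra. }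
split; [now apply (solves_uniquely_f_ d b) |]. split; [easy |].
split.
{ apply (stefan_solution_similarity d b); try easy. now rewrite <- Vh_clamp by lra. }
split; [easy |].
intros x t Ht xi Hxi. unfold temp. fold xi. now rewrite clamp_id.
Qed.
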